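(* Suppose that $V$ has only even dimensional cohomology classes (or that only even dimensional cohomology classes are considered). Then the genus-$0$ free energy $F_0$ of $V$ satisfies the genus-$0$ $L_1$ and $L_2$ constraints, i.e. $\Psi_{0,1}=0$ and $\Psi_{0,2}=0$ identically, where $$\Psi_{0,1}=\sum_{m,\alpha}(m+b_\alpha)(m+b_\alpha+1)\,\tilde t^\alpha_m\langle\langle\tau_{m+1}(\mathcal O_\alpha)\rangle\rangle_0+\sum_{m,\alpha,\beta}(2m+2b_\alpha+1)\,\mathcal C_\alpha^\beta\,\tilde t^\alpha_m\langle\langle\tau_m(\mathcal O_\beta)\rangle\rangle_0+\sum_{m,\alpha,\beta}(\mathcal C^2)_\alpha^\beta\,\tilde t^\alpha_m\langle\langle\tau_{m-1}(\mathcal O_\beta)\rangle\rangle_0$$ $$\qquad+\frac12\sum_\alpha b_\alpha(1-b_\alpha)\langle\langle\mathcal O_\alpha\rangle\rangle_0\langle\langle\mathcal O^\alpha\rangle\rangle_0+\frac12\sum_{\alpha,\beta}(\mathcal C^2)_{\alpha\beta}t^\alpha_0t^\beta_0$$ and $$\Psi_{0,2}=\sum_{m,\alpha}(m+b_\alpha)(m+b_\alpha+1)(m+b_\alpha+2)\,\tilde t^\alpha_m\langle\langle\tau_{m+2}(\mathcal O_\alpha)\rangle\rangle_0+\sum_{m,\alpha,\beta}\{3(m+b_\alpha)^2+6(m+b_\alpha)+2\}\,\mathcal C_\alpha^\beta\,\tilde t^\alpha_m\langle\langle\tau_{m+1}(\mathcal O_\beta)\rangle\rangle_0$$ $$\qquad+\sum_{m,\alpha,\beta}3(m+b_\alpha+1)(\mathcal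 C^2)_\alpha^\beta\,\tilde t^\alpha_m\langle\langle\tau_m(\mathcal O_\beta)\rangle\rangle_0+\sum_{m,\alpha,\beta}(\mathcal C^3)_\alpha^\beta\,\tilde t^\alpha_m\langle\langle\tau_{m-1}(\mathcal O_\beta)\rangle\rangle_0$$ $$\qquad-\sum_\alpha(b_\alpha-1)b_\alpha(b_\alpha+1)\langle\langle\tau_1(\mathcal O_\alpha)\rangle\rangle_0\langle\langle\mathcal O^\alpha\rangle\rangle_0-\frac12\sum_{\alpha,\beta}(3b_\alpha^2-1)\,\mathcal C_\alpha^\beta\langle\langle\mathcal O_\beta\rangle\rangle_0\langle\langle\mathcal O^\alpha\rangle\rangle_0+\frac12\sum_{\alpha,\beta}(\mathcal C^3)_{\alpha\beta}t^\alpha_0t^\beta_0 .$$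
   Context: Setting. $V$ is a smooth projective variety of complex dimension $d$ or, more generally, a compact symplectic manifold of real dimension $2d$ (e.g. semi-positive) whose genus-$0$ Gromov-Witten invariants are defined and satisfy the equations (S), (D), (L), (T) below. Only even dimensional cohomology classes are considered ($H^*(V,\mathbb Q)$ denotes the even cohomology). Fix a homogeneous basis $\mathcal O_1,\dots,\mathcal O_N$ of $H^*(V,\mathbb Q)$ with $\mathcal O_1=1$ and non-decreasing degrees. Greek indices range over $1,\dots,N$; summation indices $m$ range over the non-negative integers. Put $\eta_{\alpha\beta}=\int_V\mathcal O_\alpha\cup\mathcal O_\beta$, $(\eta^{\alpha\beta})=(\eta_{\alpha\beta})^{-1}$, $\mathcal O^\alpha=\sum_\beta\eta^{\alpha\beta}\mathcal O_\beta$, $q_\alpha=\frac12\deg\mathcal O_\alpha$ (half the real degree), $b_\alpha=q_\alpha-\frac12(d-1)$. The matrix $\mathcal C=(\mathcal C_\alpha^\beta)$ is defined by $c_1(V)\cup\mathcal O_\alpha=\sum_\beta\mathcal C_\alpha^\beta\mathcal O_\beta$; $(\mathcal C^j)_\alpha^\beta$ are the entries of its $j$-th power and $(\mathcal C^j)_{\alpha\beta}=\sum_\gamma(\mathcal C^j)_\alpha^\gamma\eta_{\gamma\beta}$ (with $\mathcal C_{\alpha\beta}$ for $j=1$). Free energy. Genus-$0$ correlators are $\langle\tau_{n_1}(\mathcal O_{\alpha_1})\cdots\tau_{n_k}(\mathcal O_{\alpha_k})\rangle_0=\sum_{A\in H_2(V,\mathbb Z)}q^A\int_{[\overline{\mathcal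 M}_{0,k}(V,A)]^{\rm virt}}\prod_{i=1}^k c_1(E_i)^{n_i}\cup{\rm ev}_i^*\mathcal O_{\alpha_i}$, where $E_i$ is the line bundle whose fiber is the cotangent line at the $i$-th marked point and $q^A$ lies in the Novikov ring. The genus-$0$ free energy is the formal power series $F_0=\langle\exp\sum_{n,\alpha}t^\alpha_n\tau_n(\mathcal O_\alpha)\rangle_0$ in the variables $t^\alpha_m$ ($m\ge0$, $1\le\alpha\le N$). Put $\tilde t^\alpha_m=t^\alpha_m-\delta_{m,1}\delta_{\alpha,1}$. The operator $\tau_m(\mathcal O_\alpha)$ is identified with the vector field $\partial/\partial t^\alpha_m$, $\tau_0(\mathcal O_\alpha)=\mathcal O_\alpha$, and $\tau_m(\mathcal O_\alpha)=0$ for $m<0$. The correlation functions are $\langle\langle\tau_{m_1}(\mathcal O_{\alpha_1})\cdots\tau_{m_k}(\mathcal O_{\alpha_k})\rangle\rangle_0=\frac{\partial^k F_0}{\partial t^{\alpha_1}_{m_1}\cdots\partial t^{\alpha_k}_{m_k}}$, extended multilinearly over functions. Standing equations for $V$: (S) string: $\sum_{m,\alpha}\tilde t^\alpha_m\langle\langle\tau_{m-1}(\mathcal O_\alpha)\rangle\rangle_0=-\frac12\sum\eta_{\alpha\beta}t^\alpha_0t^\beta_0$. (D) dilaton: $\sum_{m,\alpha}\tilde t^\alpha_m\langle\langle\tau_m(\mathcal O_\alpha)\rangle\rangle_0=2F_0$. (L) Hori's equation: $\sum_{m,\alpha}(m+b_\alpha)\tilde t^\alpha_m\langle\langle\tau_m(\mathcal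 O_\alpha)\rangle\rangle_0+\sum_{m,\alpha,\beta}\mathcal C_\alpha^\beta\tilde t^\alpha_m\langle\langle\tau_{m-1}(\mathcal O_\beta)\rangle\rangle_0=-\frac12\sum\mathcal C_{\alpha\beta}t^\alpha_0t^\beta_0$. (T) genus-$0$ topological recursion: for $m>0$, $\langle\langle\tau_m(\mathcal O_\alpha)\tau_n(\mathcal O_\beta)\tau_k(\mathcal O_\gamma)\rangle\rangle_0=\sum_\sigma\langle\langle\tau_{m-1}(\mathcal O_\alpha)\mathcal O_\sigma\rangle\rangle_0\langle\langle\mathcal O^\sigma\tau_n(\mathcal O_\beta)\tau_k(\mathcal O_\gamma)\rangle\rangle_0$. Terminology. With $Z=\exp\sum_{g\ge0}\lambda^{2g-2}F_g$ the partition function and $L_n$ the Virasoro operators of Eguchi-Hori-Xiong, $\Psi_{0,n}$ is the coefficient of $\lambda^{-2}$ in $(L_nZ)/Z$; for $n=1,2$ it is the explicit expression in the claim, and the equation $\Psi_{0,n}=0$ is called the genus-$0$ $L_n$ constraint. *)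

(* Defs.v *)
From HB Require Import structures.
From mathcomp Require Import all_boot all_order all_algebra all_field.
From mathcomp Require Import finmap multiset.
From mathcomp Require Import boolp classical_sets functions cardinality fsbigop.

Set Implicit Arguments.
Unset Strict Implicit.
Unset Printing Implicit Defensive.
Import GRing.Theory.
Local Open Scope mset_scope.
Local Open Scope ring_scope.

(** * Formal power series in arbitrarily many commuting variables

    A monomial in the variables [t_i], [i : I], is a finite multiset of
    indices; a series is an arbitrary function from monomials to coefficients.
    The record wrapper keeps the convolution product apart from the pointwise
    product that the library puts on function types. *)

Section SubMultisets.
Variable I : choiceType.
Implicit Types A B M : {mset I}.

Definition submsets M : {fset {mset I}} := fset_set [set A | (A `<=` M)%mset].

(* This lemma makes [submsets] meaningful: [fset_set] is empty on infinite
   sets. *)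
Lemma submset_finite M : finite_set [set A | (A `<=` M)%mset].
Proof.
have [n] := ubnP (size M); elim: n M => // n IHn M ltMn.
case: (pselect (exists x, x \in M)) => [[x xM]|M0]; last first.
  apply: (@sub_finite_set _ _ [set mset0]); last exact: finite_set1.
  move=> A /= /msubsetP leAM; apply/msetP => y; apply/eqP.
  rewrite mset0E -leqn0 (leq_trans (leAM y)) // leqn0 mset_eq0.
  by apply/negP => yM; apply: M0; exists y.
have sM : (size (M `\ x)%mset < n)%N.
  rewrite -ltnS; apply: leq_trans ltMn; rewrite ltnS.
  have eM : M = (x +` (M `\ x))%mset.
    apply/msetP => y; rewrite mset1DE msetB1E.
    by have [->|] := eqVneq; rewrite ?subn0 // subnKC // -in_mset.
  have pM : perm_eq (x :: enum_mset (M `\ x)%mset) (enum_mset M).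
    apply/allP => y _ /=; rewrite !count_mem_mset {2}eM.
    by rewrite mset1DE [x == y]eq_sym.
  by rewrite -(perm_size pM).
apply: (@sub_finite_set _ _
  ([set A | (A `<=` M `\ x)%mset] `|`
   [set (x +` A)%mset | A in [set A | (A `<=` M `\ x)%mset]])%classic); last first.
  by rewrite finite_setU; split; [exact: IHn | apply: finite_image; exact: IHn].
move=> A /= /msubsetP leAM; case: (boolP (x \in A)) => xA.
  right; exists (A `\ x)%mset.
    by apply/msubsetP => y; rewrite !msetB1E leq_sub2r.
  apply/msetP => y; rewrite mset1DE msetB1E.
  by have [->|] := eqVneq; rewrite ?subn0 // subnKC // -in_mset.
left; apply/msubsetP => y; rewrite msetB1E.
have [->|_] := eqVneq; last by rewrite subn0.
by rewrite (mset_eq0P xA).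
Qed.

Lemma in_submsets A M : (A \in submsets M) = (A `<=` M)%mset.
Proof.
rewrite in_fset_set; last exact: submset_finite.
by apply/idP/idP => [|h]; [rewrite inE | rewrite inE].
Qed.

End SubMultisets.

Record series (I : choiceType) (R : Type) :=
  Series { coef : {mset I} -> R }.
Arguments Series {I R}.

Section SeriesRing.
Variables (I : choiceType) (K : comNzRingType) (R : comAlgType K).
Local Notation S := (series I R).
Implicit Types (f g h : S) (M : {mset I}).

HB.instance Definition _ := gen_eqMixin S.
HB.instance Definition _ := gen_choiceMixin S.

Lemma seriesP f g : coef f =1 coef g <-> f = g.
Proof.
split=> [|-> //]; case: f g => f [g] /= fg.
by congr Series; apply: funext.
Qed.

Definition series0 : S := Series (fun=> 0).
Definition series_add f g : S := Series (fun M => coef f M + coef g M).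
Definition series_opp f : S := Series (fun M => - coef f M).
Definition series1 : S := Series (fun M => (M == mset0)%:R).
Definition series_mul f g : S :=
  Series (fun M => \sum_(A <- submsets M) coef f A * coef g (M `\` A)%mset).
Definition series_scale (k : K) f : S := Series (fun M => k *: coef f M).

Fact series_addA : associative series_add.
Proof. by move=> f g h; apply/seriesP => M /=; rewrite addrA. Qed.
Fact series_addC : commutative series_add.
Proof. by move=> f g; apply/seriesP => M /=; rewrite addrC. Qed.
Fact series_add0 : left_id series0 series_add.
Proof. by move=> f; apply/seriesP => M /=; rewrite add0r. Qed.
Fact series_addN : left_inverse series0 series_opp series_add.
Proof. by move=> f; apply/seriesP => M /=; rewrite addNr. Qed.

HB.instance Definition _ := GRing.isZmodule.Build S
  series_addA series_addC series_add0 series_addN.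

Fact series_mulC : commutative series_mul.
Proof.
move=> f g; apply/seriesP => M /=.
have subK A : (A `<=` M -> M `\` (M `\` A) = A)%mset.
  move=> /msubsetP leA; apply/msetP => x.
  by rewrite !msetE2 subKn.
have inj : {in submsets M &, injective (fun A => M `\` A)%mset}.
  move=> A B; rewrite !in_submsets => /subK {2}<- /subK {2}<- -> //.
have peq : perm_eq (submsets M) [seq (M `\` A)%mset | A <- submsets M].
  apply: uniq_perm; rewrite ?map_inj_in_uniq ?fset_uniq // => A.
  apply/idP/mapP => [|[B _ ->]].
    rewrite in_submsets => leA; exists (M `\` A)%mset; last by rewrite subK.
    by rewrite in_submsets; apply/msubsetP => x; rewrite msetE2 leq_subr.
  by rewrite in_submsets; apply/msubsetP => x; rewrite msetE2 leq_subr.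
rewrite (perm_big _ peq) /= big_map big_seq [RHS]big_seq.
by apply: eq_bigr => A; rewrite in_submsets => /subK ->; rewrite mulrC.
Qed.

Fact series_mulA : associative series_mul.
Proof.
move=> f g h; apply/seriesP => M /=.
pose G A C := coef f A * coef g (C `\` A)%mset * coef h (M `\` C)%mset.
have -> : \sum_(C <- submsets M)
    (\sum_(A <- submsets C) coef f A * coef g (C `\` A)%mset) *
      coef h (M `\` C)%mset =
  \sum_(C <- submsets M) \sum_(A <- submsets M | (A `<=` C)%mset) G A C.
  rewrite big_seq [RHS]big_seq; apply: eq_bigr => C; rewrite in_submsets => leC.
  rewrite big_distrl /= -[RHS]big_filter; apply: perm_big.
  apply: uniq_perm; rewrite ?filter_uniq ?fset_uniq // => A.
  rewrite mem_filter !in_submsets.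
  by case: (boolP (A `<=` C)%mset) => // leA; rewrite (msubset_trans leA).
rewrite (exchange_big_dep predT) //=.
rewrite big_seq [RHS]big_seq; apply: eq_bigr => A; rewrite in_submsets => leA.
rewrite -[RHS]big_filter.
have leAx := msubsetP leA.
have peq : perm_eq [seq C <- submsets M | (A `<=` C)%mset]
                   [seq (A `+` B)%mset | B <- submsets (M `\` A)%mset].
  apply: uniq_perm; rewrite ?filter_uniq ?fset_uniq //.
    rewrite map_inj_uniq ?fset_uniq // => B C /msetP eBC.
    by apply/msetP => x; have := eBC x; rewrite !msetE2 => /addnI.
  move=> C; rewrite mem_filter in_submsets.
  apply/andP/mapP => [[/msubsetP AC /msubsetP CM]|[B]].
    exists (C `\` A)%mset.
      by rewrite in_submsets; apply/msubsetP => x; rewrite !msetE2 leq_sub2r.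
    by apply/msetP => x; rewrite !msetE2 subnKC.
  rewrite in_submsets => /msubsetP leB ->; split; apply/msubsetP => x.
    by rewrite msetE2 leq_addr.
  have := leB x; rewrite !msetE2 => /(leq_add (leqnn (A x)))/leq_trans-> //.
  by rewrite subnKC.
rewrite (perm_big _ peq) /= big_map big_distrr /=.
apply: eq_bigr => B _; rewrite /G mulrA; congr (_ * coef g _ * coef h _).
  by apply/msetP => x; rewrite !msetE2 addKn.
by apply/msetP => x; rewrite !msetE2 subnDA.
Qed.

Fact series_mul1 : left_id series1 series_mul.
Proof.
move=> f; apply/seriesP => M /=.
rewrite (bigD1_seq mset0) ?fset_uniq //=; last first.
  by rewrite in_submsets; apply/msubsetP => x; rewrite mset0E.
rewrite eqxx mul1r big1 ?addr0 => [|A /negPf->]; last by rewrite mul0r.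
by congr coef; apply/msetP => x; rewrite msetE2 mset0E subn0.
Qed.

Fact series_mulDl : left_distributive series_mul series_add.
Proof.
move=> f g h; apply/seriesP => M /=; rewrite -big_split /=.
by apply: eq_bigr => A _; rewrite mulrDl.
Qed.

Fact series1_neq0 : series1 != 0.
Proof.
apply/eqP => /seriesP/(_ mset0) /= /eqP.
by rewrite eqxx oner_eq0.
Qed.

HB.instance Definition _ := GRing.Zmodule_isComNzRing.Build S
  series_mulA series_mulC series_mul1 series_mulDl series1_neq0.

Fact series_scaleA a b f :
  series_scale a (series_scale b f) = series_scale (a * b) f.
Proof. by apply/seriesP => M /=; rewrite scalerA. Qed.
Fact series_scale1 : left_id 1 series_scale.
Proof. by move=> f; apply/seriesP => M /=; rewrite scale1r. Qed.
Fact series_scaleDr : right_distributive series_scale +%R.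
Proof. by move=> a f g; apply/seriesP => M /=; rewrite scalerDr. Qed.
Fact series_scaleDl f : {morph series_scale^~ f : a b / a + b}.
Proof. by move=> a b; apply/seriesP => M /=; rewrite scalerDl. Qed.

HB.instance Definition _ := GRing.Zmodule_isLmodule.Build K S
  series_scaleA series_scale1 series_scaleDr series_scaleDl.

Fact series_scaleAl (a : K) (f g : S) : a *: (f * g) = (a *: f) * g.
Proof.
apply/seriesP => M /=; rewrite scaler_sumr.
by apply: eq_bigr => A _; rewrite scalerAl.
Qed.

HB.instance Definition _ := GRing.Lmodule_isLalgebra.Build K S series_scaleAl.
HB.instance Definition _ := GRing.Lalgebra_isComAlgebra.Build K S.

Definition series_var (i : I) : S := Series (fun M => (M == [mset i]%mset)%:R).

Definition series_deriv (i : I) f : S :=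
  Series (fun M => coef f (i +` M)%mset *+ (M i).+1).

(* A sum over all m : nat, meant for families of which only finitely many
   members involve any given monomial (multiplying the m-th member by [t_m]
   ensures this); [\sum_(m \in A)] is the library's sum
   of a finitely supported family. *)
Definition series_sum (f : nat -> S) : S :=
  Series (fun M => \sum_(m \in [set: nat]) coef (f m) M).

End SeriesRing.

Notation "\isum_ m F" := (series_sum (fun m : nat => F))
  (at level 41, m at level 0, F at level 41) : ring_scope.

(** * The even cohomology ring of the target *)

(* [H] is the even rational cohomology with the cup product as its product,
   [Hdeg q] is the summand H^{2q}, and [d] is half the real dimension. *)
Record even_cohomology (d : nat) (H : falgType rat) := EvenCohomology {
  Hdeg : nat -> {vspace H};
  Hdeg_full : (\sum_(q < d.+1) Hdeg q)%VS = fullv;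
  Hdeg_direct : directv (\sum_(q < d.+1) Hdeg q);
  Hdeg_gt_dim : forall q, (d < q)%N -> Hdeg q = 0%VS;
  cup_one : 1 \in Hdeg 0;
  cup_deg : forall p q (x y : H),
    x \in Hdeg p -> y \in Hdeg q -> x * y \in Hdeg (p + q);
  cup_comm : forall x y : H, x * y = y * x;
  integral : {linear H -> rat^o};
  integral_deg : forall q x, x \in Hdeg q -> q != d -> integral x = 0;
  poincare_duality : forall x, (forall y, integral (x * y) = 0) -> x = 0;
  chern1 : H;
  chern1_deg : chern1 \in Hdeg 1
}.

(* The rank is N.+1 and indices start at 0, so [ord0] is the index of the unit
   class; [hb_q a] is half the real degree of the a-th class. *)
Record homogeneous_basis (d : nat) (H : falgType rat)
    (V : even_cohomology d H) (N : nat) := HomogeneousBasis {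
  hb :> N.+1.-tuple H;
  hb_basis : basis_of fullv hb;
  hb_q : 'I_N.+1 -> nat;
  hb_homogeneous : forall a, tnth hb a \in Hdeg V (hb_q a);
  hb_one : tnth hb ord0 = 1;
  hb_sorted : forall a b : 'I_N.+1, (a <= b)%N -> (hb_q a <= hb_q b)%N
}.

Section Virasoro.
Variables (d : nat) (H : falgType rat) (V : even_cohomology d H).
Variables (N : nat) (O : homogeneous_basis V N).
Local Notation index := 'I_N.+1.

Definition eta : 'M[rat]_N.+1 :=
  \matrix_(a, b) integral V (tnth O a * tnth O b).
Definition eta_inv : 'M[rat]_N.+1 := invmx eta.

Definition bq (a : index) : rat := (hb_q O a)%:R - (d%:R - 1) / 2%:R.

Definition Cmx : 'M[rat]_N.+1 :=
  \matrix_(a, b) coord O b (chern1 V * tnth O a).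
Definition Clow (j : nat) : 'M[rat]_N.+1 := Cmx ^+ j *m eta.

(** * Correlators, the free energy and its correlation functions

    [corr [mset (n_1, a_1); ...; (n_k, a_k)]] is the correlator
    <tau_{n_1}(O_{a_1}) ... tau_{n_k}(O_{a_k})>_0; it does not depend on the
    order of the insertions because all classes have even degree.  [L] is any
    commutative Q-algebra in which the correlators live, such as the Novikov
    ring. *)
Variables (L : comAlgType rat) (corr : {mset nat * index} -> L).
Local Notation S := (series (nat * index)%type L).

(* The coefficient of t^M in < exp (sum t tau) >_0. *)
Definition F0 : S :=
  Series (fun M => ((\prod_(i <- finsupp M) (M i)`!)%:R)^-1 *: corr M).

Definition tvar (m : nat) (a : index) : S := series_var L (m, a).
Definition ttilde (m : nat) (a : index) : S :=
  tvar m a - ((m == 1%N) && (a == ord0))%:R.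

Definition tau (m : int) (a : index) (f : S) : S :=
  if m is Posz n then series_deriv (n, a) f else 0.

Definition cf (s : seq (int * index)) : S :=
  foldr (fun i f => tau i.1 i.2 f) F0 s.

(* << O^a tau_{m_1}(O_{a_1}) ... >>_0, first class raised by the pairing *)
Definition cf_up (a : index) (s : seq (int * index)) : S :=
  \sum_b eta_inv a b *: cf ((0, b) :: s).

Definition string_equation : Prop :=
  \isum_m (\sum_a ttilde m a * cf [:: (m%:Z - 1, a)])
  = - (2%:R^-1 *: \sum_a \sum_b eta a b *: (tvar 0 a * tvar 0 b)).

Definition dilaton_equation : Prop :=
  \isum_m (\sum_a ttilde m a * cf [:: (m%:Z, a)]) = 2%:R *: F0.

Definition hori_equation : Prop :=
  \isum_m (\sum_a (m%:R + bq a) *: (ttilde m a * cf [:: (m%:Z, a)]))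
  + \isum_m (\sum_a \sum_b Cmx a b *: (ttilde m a * cf [:: (m%:Z - 1, b)]))
  = - (2%:R^-1 *: \sum_a \sum_b Clow 1 a b *: (tvar 0 a * tvar 0 b)).

Definition topological_recursion : Prop :=
  forall (m n k : nat) (a b c : index), (0 < m)%N ->
  cf [:: (m%:Z, a); (n%:Z, b); (k%:Z, c)]
  = \sum_s cf [:: (m%:Z - 1, a); (0, s)] * cf_up s [:: (n%:Z, b); (k%:Z, c)].

Definition Psi01 : S :=
  \isum_m (\sum_a ((m%:R + bq a) * (m%:R + bq a + 1)) *:
     (ttilde m a * cf [:: (m%:Z + 1, a)]))
  + \isum_m (\sum_a \sum_b ((2 * m%:R + 2 * bq a + 1) * Cmx a b) *:
     (ttilde m a * cf [:: (m%:Z, b)]))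
  + \isum_m (\sum_a \sum_b (Cmx ^+ 2) a b *:
     (ttilde m a * cf [:: (m%:Z - 1, b)]))
  + 2%:R^-1 *: \sum_a (bq a * (1 - bq a)) *: (cf [:: (0, a)] * cf_up a [::])
  + 2%:R^-1 *: \sum_a \sum_b Clow 2 a b *: (tvar 0 a * tvar 0 b).

Definition Psi02 : S :=
  \isum_m (\sum_a
     ((m%:R + bq a) * (m%:R + bq a + 1) * (m%:R + bq a + 2)) *:
     (ttilde m a * cf [:: (m%:Z + 2, a)]))
  + \isum_m (\sum_a \sum_b
     ((3 * (m%:R + bq a) ^+ 2 + 6 * (m%:R + bq a) + 2) * Cmx a b) *:
     (ttilde m a * cf [:: (m%:Z + 1, b)]))
  + \isum_m (\sum_a \sum_b (3 * (m%:R + bq a + 1) * (Cmx ^+ 2) a b) *: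
     (ttilde m a * cf [:: (m%:Z, b)]))
  + \isum_m (\sum_a \sum_b (Cmx ^+ 3) a b *:
     (ttilde m a * cf [:: (m%:Z - 1, b)]))
  - \sum_a ((bq a - 1) * bq a * (bq a + 1)) *:
     (cf [:: (1, a)] * cf_up a [::])
  - 2%:R^-1 *: \sum_a \sum_b ((3 * bq a ^+ 2 - 1) * Cmx a b) *:
     (cf [:: (0, b)] * cf_up a [::])
  + 2%:R^-1 *: \sum_a \sum_b Clow 3 a b *: (tvar 0 a * tvar 0 b).

End Virasoro.

(* Main.v *)
Require Import Defs.
From HB Require Import structures.
From mathcomp Require Import all_boot all_order all_algebra all_field.
From mathcomp Require Import finmap multiset.
From mathcomp Require Import boolp classical_sets functions cardinality fsbigop.
From mathcomp Require Import ring.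

Set Implicit Arguments.
Unset Strict Implicit.
Unset Printing Implicit Defensive.
Import GRing.Theory.
Local Open Scope ring_scope.

(** Write [t~_m] for the row of dilaton-shifted variables, [p_n] for the column
    of one-point functions << tau_n >>, [Phi_(k,n)] for the matrix of two-point
    functions << tau_k tau_n >>, and put [p_(-1) := eta t_0^T].  Let [D_n] be the
    diagonal matrix with entries [n + b_a].  In Givental's language the pairs
    (t~, p) sweep out a Lagrangian cone.  Each tangent space T of the cone satisfies
    z T = (cone intersected with T), and Hori's equation says that an infinitesimal
    symplectic operator l_0 is tangent to the cone; together these give
    l_0 (z T) inside T.  As the point f of the cone lies in z T, all the operators
    l_n = l_0 (z l_0)^n send f into T, and T is isotropic and contains f; the
    pairing of l_n f with f is, up to sign, 2 Psi_(0,n), so Psi_(0,n) vanishes.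

    This argument is carried out in coordinates.  The only infinite sums that
    occur have the form [sum_m t~_m v_m] ([tilde_sum]).  Such a sum is linear, can
    be differentiated termwise, and two of them commute.

    - Differentiating the string and Hori equations twice and applying the
      topological recursion gives the two-point identity
      [Phi_(k+1,n) + Phi_(k,n+1) = Phi_(k,0) eta^-1 Phi_(0,n)]
      ([twopt_shift], the counterpart of z T inside the cone) and
      [hori_deriv2] (the tangency of l_0, with third derivatives that still obey
      the topological recursion).

    - Starting with the string equation as the case l_(-1), the rule
      [P'_n = D_n P_(n+1) + C P_n] raises the order by one.  The tangency
      statement [vir_field_twopt], that a vector field X^i satisfies
      [X^i Phi_(.,n) = - P^i_n], is preserved by each step.

    - By the dilaton equation, [p] is [Phi] contracted with [t~], so that
      [X^i p = - sum_m t~_m P^i_m] ([virasoro]).  On the other hand, unrolling the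
      recursive definition expresses [X^i p] as [sum_m t~_m P^i_m] plus finitely
      many quadratic terms.  Equating the two gives twice the L_1 constraint for
      the second step and twice the L_2 constraint for the third
      ([virasoro1], [virasoro2]).

    The quadratic terms take the form of the theorem because
    [D_0 eta^-1 = eta^-1 (1 - D_0)] and [C D_n = D_(n+1) C], which express that
    the pairing and the product with c_1 are homogeneous. *)

(** * Derivatives of series *)

Section SeriesCalculus.
Local Open Scope mset_scope.
Variables (I : choiceType) (L : comAlgType rat).
Local Notation S := (series I L).
Implicit Types (f g h : S) (M A : {mset I}) (i j : I).

Lemma coef_add f g M : coef (f + g) M = coef f M + coef g M.
Proof. by []. Qed.

Lemma coef_series_sum (J : Type) (r : seq J) (P : pred J) (F : J -> S) M :
  coef (\sum_(x <- r | P x) F x) M = \sum_(x <- r | P x) coef (F x) M.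
Proof. by apply: (big_morph (fun f => coef f M)). Qed.

Lemma coef_var_mul i g M :
  coef (series_var L i * g) M = if i \in M then coef g (M `\ i)%mset else 0.
Proof.
rewrite /= ; case: ifP => [iM|iM].
  rewrite (bigD1_seq [mset i]%mset) ?fset_uniq //=.
    by rewrite eqxx mul1r big1 ?addr0 // => A /negPf ->; rewrite mul0r.
  rewrite in_submsets; apply/msubsetP => x; rewrite msetnE.
  by case: eqP => // ->; rewrite mset_gt0.
rewrite big_seq big1 // => A; rewrite in_submsets => /msubsetP leA.
case: eqP => [eA|_]; last by rewrite mul0r.
by have := leA i; rewrite eA msetnxx mset_gt0 iM.
Qed.

Lemma coef_dvar i f M :
  coef (series_deriv i f) M = coef f (i +` M)%mset *+ (M i).+1.
Proof. by []. Qed.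

Lemma series_derivC i j f :
  series_deriv i (series_deriv j f) = series_deriv j (series_deriv i f).
Proof.
apply/seriesP => M; rewrite !coef_dvar -!mulrnA !mset1DE msetDCA.
by rewrite eq_sym; case: eqP => [->|_] //; rewrite !add0n mulnC.
Qed.

Fact deriv_is_linear i : linear (@series_deriv I rat L i).
Proof.
by move=> k f g; apply/seriesP => M /=; rewrite mulrnDl scalerMnr.
Qed.
HB.instance Definition _ i :=
  GRing.isLinear.Build rat S S _ (@series_deriv I rat L i) (deriv_is_linear i).

(** The Leibniz rule is needed only for products with a variable, because all
    the equations to be differentiated are linear in the shifted variables or
    quadratic in [t_0]. *)
Lemma deriv_var_mul i j g :
  series_deriv i (series_var L j * g) =
  (i == j)%:R * g + series_var L j * series_deriv i g.
Proof.
apply/seriesP => M.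
rewrite coef_add coef_dvar !coef_var_mul coef_dvar in_mset1D [j == i]eq_sym.
have [<-|nij] := eqVneq i j.
  rewrite mul1r msetD1K mulrS; congr (_ + _).
  case: ifP => [iM|/negbT/mset_eq0P->] //.
  rewrite msetB1K // msetB1E eqxx subn1 prednK // mset_gt0 //.
rewrite mul0r add0r /=; case: ifP => // jM; last by rewrite mul0rn.
rewrite msetB1E (negPf nij) subn0; congr (coef g _ *+ _).
apply/msetP => x; rewrite !(mset1DE, msetB1E).
case: (eqVneq x j) => [->|_]; last by rewrite !subn0.
by rewrite eq_sym (negPf nij).
Qed.

Lemma deriv_one i : series_deriv i (1 : S) = 0.
Proof.
apply/seriesP => M /=; case: eqP => [/msetP/(_ i)|]; last by rewrite mul0rn.
by rewrite mset1DE eqxx mset0E.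
Qed.

End SeriesCalculus.

(** * Sums against the dilaton-shifted variables *)

Lemma trmx_add (R : nmodType) m n (A B : 'M[R]_(m, n)) : (A + B)^T = A^T + B^T.
Proof. exact: raddfD. Qed.

Lemma trmx11 (R : Type) (A : 'M[R]_1) : A^T = A.
Proof. by apply/matrixP => i j; rewrite mxE !ord1. Qed.

Section DilatonShiftedSums.
Local Open Scope mset_scope.
Variables (N : nat) (L : comAlgType rat).
Local Notation I := (nat * 'I_N.+1)%type.
Local Notation S := (series I L).
Implicit Types (M A : {mset I}).

Definition tilde_row (m : nat) : 'rV[S]_N.+1 := \row_a ttilde L m a.

Definition tilde_sum r (v : nat -> 'M[S]_(N.+1, r)) : 'rV[S]_r :=
  \row_j \isum_m (\sum_a ttilde L m a * v m a j).

Definition deriv_mx (x : I) p r (A : 'M[S]_(p, r)) : 'M[S]_(p, r) :=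
  map_mx (series_deriv x) A.

(** The congruence that sees only the divisors of the monomial [M]. It is
    compatible with products, and modulo it every sum against the shifted
    variables becomes finite. *)
Definition eqmod M p r (A B : 'M[S]_(p, r)) : Prop :=
  forall i j (K : {mset I}), (K `<=` M)%mset -> coef (A i j) K = coef (B i j) K.

Lemma eqmodP p r (A B : 'M[S]_(p, r)) : (forall M, eqmod M A B) -> A = B.
Proof.
move=> eqAB; apply/matrixP => i j; apply/seriesP => M.
by apply: (eqAB M); rewrite msubset_refl.
Qed.

Lemma eqmodD M p r (A B A' B' : 'M[S]_(p, r)) :
  eqmod M A A' -> eqmod M B B' -> eqmod M (A + B) (A' + B').
Proof. by move=> eA eB i j K KM; rewrite !mxE !coef_add eA ?eB. Qed.

Lemma eqmodM M p q r (A A' : 'M[S]_(p, q)) (B B' : 'M[S]_(q, r)) :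
  eqmod M A A' -> eqmod M B B' -> eqmod M (A *m B) (A' *m B').
Proof.
move=> eA eB i j K KM; rewrite !mxE !coef_series_sum; apply: eq_bigr => k _ /=.
rewrite big_seq [RHS]big_seq; apply: eq_bigr => X; rewrite in_submsets => XK.
rewrite eA ?eB //; last exact: (msubset_trans XK).
by apply: msubset_trans KM; apply/msubsetP => x; rewrite msetE2 leq_subr.
Qed.

Lemma eqmod_refl M p r (A : 'M[S]_(p, r)) : eqmod M A A.
Proof. by []. Qed.

Lemma eqmod_sum M p r n (F G : 'I_n -> 'M[S]_(p, r)) :
  (forall k, eqmod M (F k) (G k)) -> eqmod M (\sum_k F k) (\sum_k G k).
Proof.
move=> eFG i j K KM; rewrite !summxE !coef_series_sum.
by apply: eq_bigr => k _; exact: eFG.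
Qed.

(** A monomial involves finitely many variables; beyond them, and beyond the
    shift at [m = 1], multiplication by the shifted variable contributes
    nothing. *)
Lemma coef_tilde_far M :
  exists B0, forall m a g K, (B0 <= m)%N -> (K `<=` M)%mset ->
    coef (ttilde L m a * g) K = 0.
Proof.
exists (\max_(x <- finsupp M) x.1 + 2)%N => m a g K lem KM.
rewrite /ttilde; have -> : (m == 1%N) = false.
  by apply/eqP => m1; move: lem; rewrite m1 addn2.
rewrite subr0 coef_var_mul; case: ifP => // /(msubset_subset KM) maM.
suff: (m <= \max_(x <- finsupp M) x.1)%N.
  by move=> /(leq_trans lem); rewrite -[leqRHS]addn0 leq_add2l.
by rewrite (big_rem (m, a)) ?msuppE //= leq_max leqnn.
Qed.

(** All properties of [tilde_sum] reduce to those of finite sums through this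
    truncation, whose bound does not depend on [v]. *)
Lemma tilde_sum_trunc M :
  exists B0, forall B, (B0 <= B)%N -> forall r (v : nat -> 'M[S]_(N.+1, r)),
    eqmod M (tilde_sum v) (\sum_(m < B) tilde_row m *m v m).
Proof.
have [B0 far] := coef_tilde_far M; exists B0 => B leB r v i j K KM.
rewrite summxE coef_series_sum mxE /=.
rewrite (@fsbigE _ _ _ _ _ (iota 0 B)) ?iota_uniq //.
  rewrite -[RHS](big_mkord xpredT (fun m => coef ((tilde_row m *m v m) i j) K)).
  rewrite /index_iota subn0; apply: eq_big => [m|m _]; first by rewrite in_setT.
  rewrite !mxE.
  by congr coef; apply: eq_bigr => a _; rewrite !mxE.
move=> m _; rewrite mem_iota add0n /= -leqNgt => leBm.
by rewrite coef_series_sum big1 // => a _; rewrite far // (leq_trans leB).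
Qed.

Lemma eq_tilde_sum r (v w : nat -> 'M[S]_(N.+1, r)) :
  v =1 w -> tilde_sum v = tilde_sum w.
Proof. by move=> /funext ->. Qed.

Lemma tilde_sumD r (v w : nat -> 'M[S]_(N.+1, r)) :
  tilde_sum (fun m => v m + w m) = tilde_sum v + tilde_sum w.
Proof.
apply: eqmodP => M; have [B /(_ _ (leqnn B)) trunc] := tilde_sum_trunc M.
move=> i j K KM; rewrite trunc //.
have -> : \sum_(m < B) tilde_row m *m (v m + w m)
    = \sum_(m < B) tilde_row m *m v m + \sum_(m < B) tilde_row m *m w m.
  by rewrite -big_split; apply: eq_bigr => m _; rewrite mulmxDr.
by rewrite (eqmodD (trunc _ v) (trunc _ w)).
Qed.

Lemma tilde_sumM r s (v : nat -> 'M[S]_(N.+1, r)) (A : 'M[S]_(r, s)) :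
  tilde_sum (fun m => v m *m A) = tilde_sum v *m A.
Proof.
apply: eqmodP => M; have [B /(_ _ (leqnn B)) trunc] := tilde_sum_trunc M.
move=> i j K KM; rewrite trunc //.
have -> : \sum_(m < B) tilde_row m *m (v m *m A)
    = (\sum_(m < B) tilde_row m *m v m) *m A.
  by rewrite mulmx_suml; apply: eq_bigr => m _; rewrite mulmxA.
by rewrite (eqmodM (trunc _ v) (@eqmod_refl _ _ _ A)).
Qed.

Lemma tilde_sumN r (v : nat -> 'M[S]_(N.+1, r)) :
  tilde_sum (fun m => - v m) = - tilde_sum v.
Proof.
have := tilde_sumM v (- 1%:M); rewrite mulmxN mulmx1 => <-.
by apply: eq_tilde_sum => m; rewrite mulmxN mulmx1.
Qed.

Lemma tilde_sumB r (v w : nat -> 'M[S]_(N.+1, r)) :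
  tilde_sum (fun m => v m - w m) = tilde_sum v - tilde_sum w.
Proof. by rewrite tilde_sumD tilde_sumN. Qed.

Lemma tilde_sum0 r : tilde_sum (fun=> 0 : 'M[S]_(N.+1, r)) = 0.
Proof.
rewrite -[RHS](subrr (tilde_sum (fun=> 0))) -tilde_sumB.
by apply: eq_tilde_sum => m; rewrite subr0.
Qed.

Lemma tilde_sum_head r (w : 'M[S]_(N.+1, r)) :
  tilde_sum (fun m => if m is 0 then w else 0) = tilde_row 0 *m w.
Proof.
apply: eqmodP => M; have [B trunc] := tilde_sum_trunc M.
move=> i j K KM; rewrite (trunc B.+1) //; congr (coef (fun_of_matrix _ _ _) _).
by rewrite big_ord_recl /= big1 ?addr0 // => m _; rewrite mulmx0.
Qed.

(** The two double sums agree after truncation at the same bound, where they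
    are finite. *)
Lemma tilde_sum_exchange (f : nat -> nat -> 'M[S]_N.+1) :
  tilde_sum (fun k => (tilde_sum (fun j => (f k j)^T))^T)
  = tilde_sum (fun j => (tilde_sum (fun k => f k j))^T).
Proof.
apply: eqmodP => M; have [B /(_ _ (leqnn B)) trunc] := tilde_sum_trunc M.
have trT r (v : nat -> 'M[S]_(N.+1, r)) :
    eqmod M (tilde_sum v)^T (\sum_(m < B) tilde_row m *m v m)^T.
  by move=> i j K KM; rewrite mxE trunc // [in RHS]mxE.
have trD (v w : nat -> 'cV[S]_N.+1) : (forall k, eqmod M (v k) (w k)) ->
    eqmod M (tilde_sum v) (\sum_(k < B) tilde_row k *m w k).
  move=> eqvw i j K KM; apply: etrans (trunc _ v i j K KM) _.
  by apply: (eqmod_sum (fun k => eqmodM (@eqmod_refl M _ _ _) (eqvw k))).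
move=> i j K KM; apply: etrans (trD _ _ (fun k => trT _ _) i j K KM) _.
apply: etrans _ (esym (trD _ _ (fun k => trT _ _) i j K KM)).
congr (coef (fun_of_matrix _ _ _) _).
transitivity (\sum_(k < B) \sum_(l < B) tilde_row k *m f k l *m (tilde_row l)^T).
  apply: eq_bigr => k _; rewrite raddf_sum mulmx_sumr; apply: eq_bigr => l _.
  by rewrite /= trmx_mul trmxK mulmxA.
rewrite exchange_big; apply: eq_bigr => l _.
rewrite raddf_sum mulmx_sumr; apply: eq_bigr => k _.
by rewrite -[RHS]trmx11 /= !trmx_mul !trmxK.
Qed.

Lemma deriv_mxD x p r (A B : 'M[S]_(p, r)) :
  deriv_mx x (A + B) = deriv_mx x A + deriv_mx x B.
Proof. by apply/matrixP => i j; rewrite !mxE raddfD. Qed.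

Lemma deriv_ttilde_mul n (b : 'I_N.+1) m a (g : S) :
  series_deriv (n, b) (ttilde L m a * g)
  = ((m == n) && (a == b))%:R * g + ttilde L m a * series_deriv (n, b) g.
Proof.
rewrite /ttilde !mulrBl raddfB /= deriv_var_mul xpair_eqE.
rewrite [n == m]eq_sym [b == a]eq_sym.
rewrite -addrA; congr (_ + (_ - _)).
by case: (_ && _); rewrite ?mul1r ?mul0r // raddf0.
Qed.

Lemma deriv_mx_tilde_row_mul n b m r (A : 'M[S]_(N.+1, r)) :
  deriv_mx (n, b) (tilde_row m *m A)
  = (m == n)%:R *: row b A + tilde_row m *m deriv_mx (n, b) A.
Proof.
apply/matrixP => i j; rewrite !mxE raddf_sum /=.
have -> : (m == n)%:R * A b j = \sum_a ((m == n) && (a == b))%:R * A a j.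
  rewrite (bigD1 b) //= eqxx andbT big1 ?addr0 // => a /negPf ->.
  by rewrite andbF mul0r.
rewrite -big_split; apply: eq_bigr => a _; rewrite !mxE.
exact: deriv_ttilde_mul.
Qed.

(** The derivative along the variable [(n, b)] meets the shifted variables only
    in the term [m = n]; the truncation is taken modulo the monomial enlarged
    by that variable. *)
Lemma deriv_mx_tilde_sum n b r (v : nat -> 'M[S]_(N.+1, r)) :
  deriv_mx (n, b) (tilde_sum v)
  = row b (v n) + tilde_sum (fun m => deriv_mx (n, b) (v m)).
Proof.
apply: eqmodP => M; have [B0 trunc] := tilde_sum_trunc ((n, b) +` M)%mset.
pose B := maxn B0 n.+1; have /trunc{}trunc : (B0 <= B)%N by rewrite leq_maxl.
have ltn : (n < B)%N by rewrite leq_maxr.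
have leS K : (K `<=` M)%mset -> (K `<=` (n, b) +` M)%mset.
  move=> /msubsetP KM; apply/msubsetP => x.
  by rewrite mset1DE (leq_trans (KM x)) ?leq_addl.
move=> i j K KM; rewrite [LHS]/= mxE coef_dvar trunc; last first.
  by apply/msubsetP => x; rewrite !mset1DE leq_add2l; apply/msubsetP: x.
rewrite -coef_dvar [in RHS]mxE coef_add trunc ?leS // -coef_add; congr coef.
transitivity ((\sum_(m < B) deriv_mx (n, b) (tilde_row m *m v m)) i j).
  by rewrite !summxE raddf_sum; apply: eq_bigr => m _ /=; rewrite [RHS]mxE.
transitivity ((row b (v n)
    + \sum_(m < B) tilde_row m *m deriv_mx (n, b) (v m)) i j);
  last by rewrite [LHS]mxE.
congr (fun_of_matrix _ _ _); under eq_bigr do rewrite deriv_mx_tilde_row_mul.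
rewrite big_split (bigD1 (Ordinal ltn)) //= eqxx scale1r big1 ?addr0 //.
by move=> m; rewrite -val_eqE /= => /negPf ->; rewrite scale0r.
Qed.

Lemma deriv_mx_tilde_row n b m :
  deriv_mx (n, b) (tilde_row m) = (m == n)%:R *: delta_mx 0 b.
Proof.
rewrite -[tilde_row m]mulmx1 deriv_mx_tilde_row_mul row1.
rewrite [X in tilde_row m *m X](_ : _ = 0) ?mulmx0 ?addr0 //.
apply/matrixP => i j; rewrite !mxE; case: (i == j); last by rewrite raddf0.
exact: deriv_one.
Qed.

Lemma col_tilde_sum r (v : nat -> 'M[S]_(N.+1, r)) j :
  col j (tilde_sum v) = tilde_sum (fun m => col j (v m)).
Proof.
apply/matrixP => i k; rewrite !mxE; congr series_sum; apply: funext => m.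
by apply: eq_bigr => a _; rewrite !mxE.
Qed.

End DilatonShiftedSums.

(** * The pairing, the first Chern class and the grading *)

Definition diag_fun n (f : 'I_n -> rat) : 'M[rat]_n := diag_mx (\row_a f a).

Lemma diag_funE n (f : 'I_n -> rat) (K : 'M[rat]_n) a b :
  (diag_fun f *m K) a b = f a * K a b.
Proof. by rewrite mul_diag_mx !mxE. Qed.

Lemma diag_funM n (f g : 'I_n -> rat) :
  diag_fun f *m diag_fun g = diag_fun (fun a => f a * g a).
Proof.
by rewrite mulmx_diag; congr diag_mx; apply/rowP => a; rewrite !mxE.
Qed.

Lemma diag_funD n (f g : 'I_n -> rat) :
  diag_fun f + diag_fun g = diag_fun (fun a => f a + g a).
Proof.
by rewrite /diag_fun -raddfD; congr diag_mx; apply/rowP => a; rewrite !mxE.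
Qed.

Lemma diag_funN n (f : 'I_n -> rat) : - diag_fun f = diag_fun (fun a => - f a).
Proof.
by rewrite /diag_fun -raddfN; congr diag_mx; apply/rowP => a; rewrite !mxE.
Qed.

Lemma eq_diag_fun n (f g : 'I_n -> rat) : f =1 g -> diag_fun f = diag_fun g.
Proof. by move=> /funext ->. Qed.

Section Cohomology.
Variables (d : nat) (H : falgType rat) (V : even_cohomology d H).
Variables (N : nat) (O : homogeneous_basis V N).
Local Notation Eta := (Defs.eta O).
Local Notation C := (Cmx O).
Local Notation b := (bq O).

Definition grading (n : nat) : 'M[rat]_N.+1 := diag_mx (\row_a (n%:R + b a)).

Lemma tr_eta : Eta^T = Eta.
Proof. by apply/matrixP => i j; rewrite !mxE (cup_comm V). Qed.

Lemma basis_expand x : x = \sum_a coord O a x *: tnth O a.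
Proof.
rewrite [LHS](coord_basis (hb_basis O)) ?memvf //.
by apply: eq_bigr => a _; rewrite (tnth_nth 0).
Qed.

(** Poincare duality: a row vector in the kernel of the pairing matrix is a
    class orthogonal to every basis element. *)
Lemma eta_unit : Eta \in unitmx.
Proof.
suff inj (u : 'rV_N.+1) : u *m Eta = 0 -> u = 0.
  rewrite -row_free_unit -kermx_eq0; apply/eqP/row_matrixP => i; rewrite row0.
  by apply: inj; apply/sub_kermxP; rewrite row_sub.
move=> u0; pose x := \sum_a u 0 a *: tnth O a.
have xb c : integral V (x * tnth O c) = 0.
  have := congr1 (fun A : 'rV_N.+1 => A 0 c) u0; rewrite !mxE => <-.
  rewrite /x mulr_suml raddf_sum; apply: eq_bigr => a _.
  by rewrite -scalerAl /= linearZ mxE.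
have x0 : x = 0.
  apply: (poincare_duality (e := V)) => y.
  rewrite (basis_expand y) mulr_sumr raddf_sum big1 // => a _.
  by rewrite -scalerAr /= linearZ /= xb scaler0.
apply/rowP => a; rewrite [RHS]mxE.
have /freeP := basis_free (hb_basis O).
apply; rewrite -[RHS]x0 /x; apply: eq_bigr => c _.
by rewrite (tnth_nth 0).
Qed.

(** Lowering an index of [C] turns it into a symmetric trilinear integral; its
    symmetry and its degree are visible there. *)
Lemma integral_chern a c :
  (C *m Eta) a c = integral V (chern1 V * tnth O a * tnth O c).
Proof.
rewrite !mxE [X in integral V (X * _)]basis_expand mulr_suml raddf_sum.
by apply: eq_bigr => e _; rewrite !mxE -scalerAl /= linearZ.
Qed.

Lemma tr_C_eta : (C *m Eta)^T = C *m Eta.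
Proof.
apply/matrixP => i j; rewrite mxE !integral_chern -!mulrA.
by rewrite (cup_comm V (tnth O j)).
Qed.

Lemma trC_eta_inv : C^T *m invmx Eta = invmx Eta *m C.
Proof.
have e : Eta *m C^T = C *m Eta by rewrite -[RHS]tr_C_eta trmx_mul tr_eta.
by rewrite -[LHS](mulKmx eta_unit) (mulmxA Eta) e mulmxK ?eta_unit.
Qed.

(** The pairing vanishes unless the degrees add up to [d], that is, unless
    [b_i + b_j = 1]. *)
Lemma eta_graded n : grading n *m Eta = Eta *m ((2 * n + 1)%N%:R%:M - grading n).
Proof.
apply/matrixP => i j; rewrite mul_diag_mx mulmxBr mul_mx_scalar mul_mx_diag.
rewrite !mxE; have [e|ne] := eqVneq (hb_q O i + hb_q O j)%N d.
  have eR : d%:R = (hb_q O i)%:R + (hb_q O j)%:R :> rat by rewrite -natrD e.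
  by rewrite /bq eR; field.
rewrite (@integral_deg _ _ V (hb_q O i + hb_q O j)) ?mulr0 ?mul0r ?subr0 //.
by apply: cup_deg; apply: hb_homogeneous.
Qed.

(** The integral of [c_1 O_i O_j] vanishes unless [b_i + b_j = 0]. *)
Lemma C_eta_graded : grading 0 *m (C *m Eta) = - (C *m Eta *m grading 0).
Proof.
have := integral_chern; move: (C *m Eta) => K KE.
apply/matrixP => i j; rewrite mul_diag_mx mul_mx_diag !mxE !KE.
have [e|ne] := eqVneq (1 + hb_q O i + hb_q O j)%N d.
  have eR : d%:R = 1 + (hb_q O i)%:R + (hb_q O j)%:R :> rat.
    by rewrite -[in LHS]e !natrD.
  by rewrite /bq eR; field.
rewrite (@integral_deg _ _ V (1 + hb_q O i + hb_q O j)) //.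
  by rewrite mulr0 mul0r oppr0.
by do !apply: cup_deg; rewrite ?chern1_deg ?hb_homogeneous.
Qed.

Lemma gradingS n : grading n.+1 = grading n + 1%:M.
Proof.
apply/matrixP => i j; rewrite !mxE -natr1.
by case: eqP => _; rewrite ?mulr0n ?addr0 //= !mulr1n; ring.
Qed.

Lemma gradingE n : grading n = n%:R%:M + grading 0.
Proof.
elim: n => [|n IHn]; first by rewrite raddf0 add0r.
by rewrite gradingS IHn -natr1 raddfD addrAC.
Qed.

Lemma eta_inv_graded :
  grading 0 *m invmx Eta = invmx Eta *m (1%:M - grading 0).
Proof.
have /(congr1 (fun A => invmx Eta *m A *m invmx Eta)) := eta_graded 0.
rewrite muln0 add0n !mulmxA mulVmx ?eta_unit // mul1mx => e.
rewrite mulmxBr mulmx1 -[LHS](subKr (invmx Eta)); congr (_ - _).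
by move: e; rewrite mulmxBl mul1mx mulmxK ?eta_unit //.
Qed.

(** Multiplication by [c_1] raises the degree by one. This is read off from the
    degrees of the two bilinear forms [C eta] and [eta]. *)
Lemma C_graded n : C *m grading n = grading n.+1 *m C.
Proof.
have e0 : C *m grading 0 = grading 0 *m C + C.
  have -> : C *m grading 0 = C *m Eta *m (invmx Eta *m grading 0).
    by rewrite mulmxA mulmxK ?eta_unit.
  have -> : invmx Eta *m grading 0 = invmx Eta - grading 0 *m invmx Eta.
    by rewrite eta_inv_graded mulmxBr mulmx1 subKr.
  rewrite mulmxBr mulmxK ?eta_unit // addrC; congr (_ + _).
  by rewrite mulmxA -mulNmx -C_eta_graded !mulmxA mulmxK ?eta_unit.
by rewrite gradingS gradingE mulmxDr e0 !mulmxDl mul1mx scalar_mxC addrA.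
Qed.

Local Notation J := (invmx Eta).
Local Notation D n := (grading n).

Lemma grading_diag n : grading n = diag_fun (fun a => n%:R + b a).
Proof. by []. Qed.

Lemma grading_mul2 m :
  D m *m D m.+1 = diag_fun (fun a => (m%:R + b a) * (m%:R + b a + 1)).
Proof.
rewrite !grading_diag diag_funM; apply: eq_diag_fun => a.
by rewrite -natr1; ring.
Qed.

Lemma grading_mul3 m : D m *m D m.+1 *m D m.+2
  = diag_fun (fun a => (m%:R + b a) * (m%:R + b a + 1) * (m%:R + b a + 2)).
Proof.
rewrite grading_mul2 grading_diag diag_funM; apply: eq_diag_fun => a.
by rewrite -!natr1; ring.
Qed.

Lemma eta_inv_grading : J *m grading 0 = diag_fun (fun a => 1 - b a) *m J.
Proof.
have e1 : diag_fun (fun a => 1 - b a) = 1%:M - grading 0.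
  rewrite grading_diag; apply/matrixP => i j; rewrite !mxE.
  by case: eqP => _; rewrite ?mulr0n ?subr0 // !mulr1n add0r.
rewrite e1 mulmxBl mul1mx eta_inv_graded mulmxBr mulmx1 opprB addrC subrK //.
Qed.

Lemma grading_eta_inv_grading :
  grading 0 *m J *m grading 0 = diag_fun (fun a => b a * (1 - b a)) *m J.
Proof.
rewrite -mulmxA eta_inv_grading mulmxA grading_diag diag_funM; congr (_ *m _).
by apply: eq_diag_fun => a; ring.
Qed.

Lemma diag_fun_trC (f : rat -> rat) :
  diag_fun (fun a => f (b a)) *m C^T = C^T *m diag_fun (fun a => f (b a + 1)).
Proof.
apply/matrixP => a c; rewrite diag_funE mul_mx_diag !mxE.
have := congr1 (fun A : 'M_N.+1 => A c a) (C_graded 0).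
rewrite /grading mul_mx_diag mul_diag_mx !mxE add0r -mulrC => /eqP.
rewrite -subr_eq0 -mulrBl mulf_eq0 subr_eq0 addrC => /orP[/eqP->|/eqP->].
  by rewrite mulrC.
by rewrite mulr0 mul0r.
Qed.

(** The quadratic form in the primary one-point functions that arises in the
    second constraint. Moving all factors [D_0] between [C^T] and [eta^-1] leaves the
    polynomial [-(b+1) b + b (1-b) + (b+1) (1-b) = 1 - 3 b^2]. *)
Lemma quad02_matrix :
  grading 0 *m J *m grading 0 *m C + C^T *m (grading 0 *m J *m grading 0)
  + grading 0 *m J *m C *m grading 0
  = - (C^T *m diag_fun (fun a => 3 * b a ^+ 2 - 1) *m J).
Proof.
have -> : grading 0 *m J *m C *m grading 0
    = C^T *m diag_fun (fun a => (b a + 1) * (1 - b a)) *m J.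
  have -> : grading 0 *m J *m C *m grading 0
      = grading 0 *m C^T *m (J *m grading 0).
    by rewrite !mulmxA -(mulmxA _ C^T) trC_eta_inv !mulmxA.
  rewrite eta_inv_grading grading_diag (diag_fun_trC (fun x => 0%:R + x)) mulmxA.
  rewrite -(mulmxA C^T) diag_funM.
  by congr (_ *m _ *m _); apply: eq_diag_fun => a; ring.
rewrite grading_eta_inv_grading -(mulmxA _ J C) -trC_eta_inv !mulmxA.
rewrite [X in X *m J + _ + _](diag_fun_trC (fun x => x * (1 - x))).
rewrite -!mulmxDl -!mulmxDr !diag_funD -mulNmx -mulmxN; congr (_ *m _ *m _).
by rewrite diag_funN; apply: eq_diag_fun => a; ring.
Qed.

Lemma grading1_eta_inv_grading : grading 1 *m (grading 0 *m J *m grading 0)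
  = - (diag_fun (fun a => (b a - 1) * b a * (b a + 1)) *m J).
Proof.
rewrite grading_eta_inv_grading mulmxA grading_diag diag_funM -mulNmx.
congr (_ *m _).
by rewrite diag_funN; apply: eq_diag_fun => a; ring.
Qed.

End Cohomology.

(** * Differentiating linear constraints on the free energy *)

Section RationalMatrices.
Variables (I : choiceType) (L : comAlgType rat).
Local Notation S := (series I L).

Definition ratmx m n (A : 'M[rat]_(m, n)) : 'M[S]_(m, n) :=
  map_mx (in_alg S) A.

Lemma ratmxM m n p (A : 'M_(m, n)) (B : 'M_(n, p)) :
  ratmx (A *m B) = ratmx A *m ratmx B.
Proof. exact: map_mxM. Qed.

Lemma ratmxD m n (A B : 'M_(m, n)) : ratmx (A + B) = ratmx A + ratmx B.
Proof. exact: map_mxD. Qed.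

Lemma ratmxN m n (A : 'M_(m, n)) : ratmx (- A) = - ratmx A.
Proof. exact: map_mxN. Qed.

Lemma ratmx1 n : ratmx (1%:M : 'M_n) = 1%:M.
Proof. exact: map_mx1. Qed.

Lemma ratmx0 m n : ratmx (0 : 'M_(m, n)) = 0.
Proof. exact: map_mx0. Qed.

Lemma ratmxE m n (A : 'M_(m, n)) i j (f : S) : ratmx A i j * f = A i j *: f.
Proof. by rewrite mxE mulr_algl. Qed.

Lemma tr_ratmx m n (A : 'M_(m, n)) : (ratmx A)^T = ratmx A^T.
Proof. by rewrite /ratmx map_trmx. Qed.

End RationalMatrices.

Section GenusZero.
Variables (N : nat) (L : comAlgType rat).
Local Notation I := (nat * 'I_N.+1)%type.
Local Notation S := (series I L).
Local Notation ratmx := (@ratmx I L).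
Variable F : S.

Lemma deriv_mx_ratmx x m n p (A : 'M[rat]_(m, n)) (B : 'M[S]_(n, p)) :
  deriv_mx x (ratmx A *m B) = ratmx A *m deriv_mx x B.
Proof.
apply/matrixP => i j; rewrite !mxE raddf_sum; apply: eq_bigr => k _.
by rewrite !ratmxE /= linearZ /= [in RHS]mxE.
Qed.

Lemma deriv_mx_const x m n (A : 'M[rat]_(m, n)) : deriv_mx x (ratmx A) = 0.
Proof.
by apply/matrixP => i j; rewrite !mxE linearZ /= deriv_one scaler0.
Qed.

Lemma deriv_mx_tr x m n (B : 'M[S]_(m, n)) : deriv_mx x B^T = (deriv_mx x B)^T.
Proof. by rewrite /deriv_mx map_trmx. Qed.

Lemma col_inj m n (A B : 'M[S]_(m, n)) : (forall j, col j A = col j B) -> A = B.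
Proof.
by move=> eAB; apply/trmx_inj/row_matrixP => i; rewrite -!tr_col eAB.
Qed.

Lemma rowD m n i (A B : 'M[S]_(m, n)) : row i (A + B) = row i A + row i B.
Proof. exact: raddfD. Qed.

Lemma deriv_mxN x m n (A : 'M[S]_(m, n)) : deriv_mx x (- A) = - deriv_mx x A.
Proof. by apply/matrixP => i j; rewrite !mxE raddfN. Qed.

Lemma deriv_mxZ x m n (k : rat) (A : 'M[S]_(m, n)) :
  deriv_mx x (k%:A *: A) = k%:A *: deriv_mx x A.
Proof. by apply/matrixP => i j; rewrite !mxE !mulr_algl linearZ. Qed.

Lemma deriv_mx_nat x m n k (A : 'M[S]_(m, n)) :
  deriv_mx x (k%:R *: A) = k%:R *: deriv_mx x A.
Proof. by apply/matrixP => i j; rewrite !mxE !mulr_natl raddfMn. Qed.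

Lemma half_double m n (A : 'M[S]_(m, n)) : (2%:R^-1 : rat)%:A *: (A + A) = A.
Proof.
apply/matrixP => i j; rewrite !mxE mulr_algl -mulr2n -scaler_nat scalerA.
by rewrite mulVf ?scale1r.
Qed.

Definition onept (n : nat) : 'cV[S]_N.+1 := \col_a series_deriv (n, a) F.
Definition twopt (k n : nat) : 'M[S]_N.+1 :=
  \matrix_(a, b) series_deriv (k, a) (series_deriv (n, b) F).

(** Encodes the convention that [tau_(-1)] vanishes. *)
Definition delay (T : zmodType) (v : nat -> T) (n : nat) : T :=
  if n is k.+1 then v k else 0.

Lemma deriv_mx_double x :
  deriv_mx x ((2%:R * F)%:M : 'M_1) = (series_deriv x F *+ 2)%:M.
Proof. by apply/matrixP => i j; rewrite !mxE !ord1 !mulr1n mulr_natl raddfMn. Qed.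

Lemma row_onept n b : row b (onept n) = (series_deriv (n, b) F)%:M.
Proof. by apply/matrixP => i j; rewrite !mxE !ord1 mulr1n. Qed.

Lemma deriv_mx_onept n b k : deriv_mx (n, b) (onept k) = col b (twopt k n).
Proof. by apply/matrixP => i j; rewrite !mxE; apply: series_derivC. Qed.

Lemma tr_twopt k n : (twopt k n)^T = twopt n k.
Proof. by apply/matrixP => i j; rewrite !mxE; apply: series_derivC. Qed.

Lemma deriv_mx_delay x m p (v : nat -> 'M[S]_(m, p)) n :
  deriv_mx x (delay v n) = delay (fun k => deriv_mx x (v k)) n.
Proof.
by case: n => //=; apply/matrixP => i j; rewrite !mxE raddf0.
Qed.

(** Topological recursion, in the form that applies to derivatives of two-point
    functions: the dependence on the level [k] factors out on the right. *)
Definition two_point_recursion (G : 'M[rat]_N.+1) : Prop := forall x m k,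
  deriv_mx x (twopt m k.+1) = deriv_mx x (twopt m 0) *m ratmx G *m twopt 0 k.

Variable G : 'M[rat]_N.+1.
Hypothesis trr : two_point_recursion G.

Section LinearConstraint.
Variables (A : nat -> 'M[rat]_N.+1) (B Q : 'M[rat]_N.+1).
Hypothesis sQ : Q^T = Q.
Hypothesis constraint :
  tilde_sum (fun m => ratmx (A m) *m onept m + ratmx B *m delay onept m)
  = - ((2%:R^-1)%:A *: (tilde_row N L 0 *m ratmx Q *m (tilde_row N L 0)^T)).

(** The string equation (A = 0, B = 1, Q = eta) and Hori's equation (A = D,
    B = C, Q = C eta) share this shape, so both are differentiated at once. *)
Lemma constraint_deriv n :
  (ratmx (A n) *m onept n + ratmx B *m delay onept n)^T
  + tilde_sum (fun m => ratmx (A m) *m twopt m n + ratmx B *m delay (twopt^~ n) m)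
  = - ((n == 0)%N%:R *: (tilde_row N L 0 *m ratmx Q)).
Proof.
apply: col_inj => b; have := congr1 (@deriv_mx _ _ (n, b) _ _) constraint.
have dt : deriv_mx (n, b) ((tilde_row N L 0)^T) = (0 == n)%N%:R *: delta_mx b 0.
  by rewrite deriv_mx_tr deriv_mx_tilde_row linearZ /= trmx_delta.
rewrite deriv_mx_tilde_sum deriv_mxN deriv_mxZ -mulmxA deriv_mx_tilde_row_mul.
rewrite deriv_mx_ratmx dt eq_sym.
rewrite -!scalemxAr mulmxA -colE -[row b (ratmx Q *m _)]trmx11 tr_row.
rewrite trmx_mul trmxK tr_ratmx sQ half_double -[row b _]trmx11 tr_row => eq1.
rewrite [LHS]raddfD raddfN /= linearZ /= -eq1; congr (_ + _).
rewrite col_tilde_sum; apply: eq_tilde_sum => m.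
rewrite deriv_mxD !deriv_mx_ratmx deriv_mx_delay deriv_mx_onept.
rewrite raddfD /= !colE !mulmxA; congr (_ + _).
by case: m => [|m] /=; rewrite ?mulmx0 ?mul0mx // deriv_mx_onept colE !mulmxA.
Qed.

(** The part of the second derivative of a linear constraint in which the
    shifted variables survive; it involves third derivatives of the free energy
    only, which is why the topological recursion applies to it. *)
Definition third_deriv_sum n k : 'M[S]_N.+1 :=
  \matrix_b tilde_sum (fun m => ratmx (A m) *m deriv_mx (n, b) (twopt m k)
    + ratmx B *m delay (fun m => deriv_mx (n, b) (twopt m k)) m).

Lemma constraint_deriv2 n k :
  ratmx (A n) *m twopt n k + ratmx B *m delay (twopt^~ k) n
  + twopt n k *m (ratmx (A k))^T + delay (twopt n) k *m (ratmx B)^T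
  + third_deriv_sum n k = - ([&& n == 0 & k == 0]%N%:R *: ratmx Q).
Proof.
apply/row_matrixP => b.
have := congr1 (@deriv_mx _ _ (n, b) _ _) (constraint_deriv k).
rewrite deriv_mxD deriv_mx_tilde_sum deriv_mx_tr deriv_mxD.
rewrite !deriv_mx_ratmx deriv_mx_delay deriv_mx_onept.
rewrite deriv_mxN deriv_mx_nat deriv_mx_tilde_row_mul deriv_mx_const.
rewrite mulmx0 addr0 scalerA -natrM mulnb.
rewrite andbC [0%N == n]eq_sym [row b (- _)]rowE mulmxN -scalemxAr -rowE => <-.
rewrite addrCA addrA 3!rowD rowK; congr (_ + _); last first.
  by apply: eq_tilde_sum => m; rewrite deriv_mxD !deriv_mx_ratmx deriv_mx_delay.
rewrite -addrA; congr (_ + _).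
rewrite [RHS]raddfD /= !trmx_mul !row_mul tr_col tr_twopt; congr (_ + _ *m _).
case: k => [|k] /=; first by rewrite row0 trmx0.
by rewrite deriv_mx_onept tr_col tr_twopt.
Qed.

Lemma third_deriv_sumS n k :
  third_deriv_sum n k.+1 = third_deriv_sum n 0 *m ratmx G *m twopt 0 k.
Proof.
pose v j b m := ratmx (A m) *m deriv_mx (n, b) (twopt m j)
  + ratmx B *m delay (fun m => deriv_mx (n, b) (twopt m j)) m.
have rowR j b : row b (third_deriv_sum n j) = tilde_sum (v j b) by exact: rowK.
have vS b m : v k.+1 b m = v 0 b m *m ratmx G *m twopt 0 k.
  have delayS : delay (fun m => deriv_mx (n, b) (twopt m k.+1)) m =
      delay (fun m => deriv_mx (n, b) (twopt m 0)) m *m ratmx G *m twopt 0 k.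
    by case: m => [|m]; [rewrite /= !mul0mx | exact: (trr (n, b) m k)].
  by rewrite /v (trr (n, b) m k) delayS !mulmxDl !mulmxA.
apply/row_matrixP => b; rewrite [RHS]row_mul [X in _ = X *m _]row_mul.
apply: etrans (rowR k.+1 b) _.
apply: etrans _ (congr1 (fun X => X *m _ *m _) (esym (rowR 0 b))).
apply: etrans (eq_tilde_sum (vS b)) _.
exact: etrans (tilde_sumM _ _) (congr1 (fun X => X *m _) (tilde_sumM _ _)).
Qed.

End LinearConstraint.
End GenusZero.

(** * The four equations in matrix form *)

Section Sums.
Variables (N : nat) (L : comAlgType rat).
Local Notation I := (nat * 'I_N.+1)%type.
Local Notation S := (series I L).
Local Notation ratmx := (@ratmx I L).

Lemma ratmx_mulE (K : 'M[rat]_N.+1) (v : 'cV[S]_N.+1) a :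
  (ratmx K *m v) a 0 = \sum_b K a b *: v b 0.
Proof. by rewrite mxE; apply: eq_bigr => b _; rewrite ratmxE. Qed.

Lemma ratmx_diagE (f : 'I_N.+1 -> rat) (v : 'cV[S]_N.+1) a :
  (ratmx (diag_fun f) *m v) a 0 = f a *: v a 0.
Proof.
rewrite ratmx_mulE (bigD1 a) //= big1 => [|c /negPf nca].
  by rewrite !mxE eqxx mulr1n addr0.
by rewrite !mxE eq_sym nca mulr0n scale0r.
Qed.

Lemma isum_mx (k : nat -> 'I_N.+1 -> 'I_N.+1 -> rat) (g : nat -> 'I_N.+1 -> S)
    (K : nat -> 'M[rat]_N.+1) (v : nat -> 'cV[S]_N.+1) :
  (forall m a b, k m a b = K m a b) -> (forall m b, g m b = v m b 0) ->
  \isum_m (\sum_a \sum_b k m a b *: (ttilde L m a * g m b))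
  = tilde_sum (fun m => ratmx (K m) *m v m) 0 0.
Proof.
move=> kE gE; rewrite [RHS]mxE; congr series_sum; apply: funext => m.
apply: eq_bigr => a _; rewrite ratmx_mulE mulr_sumr; apply: eq_bigr => b _.
by rewrite kE gE scalerAr.
Qed.

Lemma isum_diag (f : nat -> 'I_N.+1 -> rat) (g : nat -> 'I_N.+1 -> S)
    (v : nat -> 'cV[S]_N.+1) :
  (forall m b, g m b = v m b 0) ->
  \isum_m (\sum_a f m a *: (ttilde L m a * g m a))
  = tilde_sum (fun m => ratmx (diag_fun (f m)) *m v m) 0 0.
Proof.
move=> gE; rewrite [RHS]mxE; congr series_sum; apply: funext => m.
by apply: eq_bigr => a _; rewrite ratmx_diagE gE scalerAr.
Qed.

Lemma isum_col (g : nat -> 'I_N.+1 -> S) (v : nat -> 'cV[S]_N.+1) :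
  (forall m b, g m b = v m b 0) ->
  \isum_m (\sum_a ttilde L m a * g m a) = tilde_sum v 0 0.
Proof.
move=> gE; rewrite [RHS]mxE; congr series_sum; apply: funext => m.
by apply: eq_bigr => a _; rewrite gE.
Qed.

Lemma quad_mx (K : 'M[rat]_N.+1) (u v : 'cV[S]_N.+1) :
  (u^T *m ratmx K *m v) 0 0 = \sum_a \sum_b K a b *: (u a 0 * v b 0).
Proof.
rewrite -mulmxA mxE; apply: eq_bigr => a _; rewrite ratmx_mulE mxE mulr_sumr.
by apply: eq_bigr => b _; rewrite scalerAr.
Qed.

End Sums.

Section Translation.
Variables (d : nat) (H : falgType rat) (V : even_cohomology d H).
Variables (N : nat) (O : homogeneous_basis V N) (L : comAlgType rat).
Variable corr : {mset nat * 'I_N.+1}%mset -> L.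
Local Notation I := (nat * 'I_N.+1)%type.
Local Notation S := (series I L).
Local Notation ratmx := (@ratmx I L).
Local Notation F := (F0 corr).
Local Notation onept := (onept F).
Local Notation twopt := (twopt F).
Local Notation t0 := (tilde_row N L 0).
Local Notation et := (ratmx (Defs.eta O)).
Local Notation ei := (ratmx (invmx (Defs.eta O))).
Local Notation C := (ratmx (Cmx O)).
Local Notation D n := (ratmx (grading O n)).
Local Notation p0 := (onept 0).
Local Notation b := (bq O).

Lemma cf_onept n a : cf corr [:: (n%:Z, a)] = onept n a 0.
Proof. by rewrite mxE. Qed.

Lemma cf_delay n a : cf corr [:: (n%:Z - 1, a)] = delay onept n a 0.
Proof.
case: n => [|n]; first by rewrite mxE.
have -> : n.+1%:Z - 1 = n%:Z by rewrite -addn1 PoszD addrK.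
exact: cf_onept.
Qed.

Lemma cf_onept1 n a : cf corr [:: (n%:Z + 1, a)] = onept n.+1 a 0.
Proof. by rewrite -PoszD addn1 cf_onept. Qed.

Lemma cf_onept2 n a : cf corr [:: (n%:Z + 2, a)] = onept n.+2 a 0.
Proof. by rewrite -[2]/(2%N%:Z) -PoszD addn2 cf_onept. Qed.

Lemma cf_up_onept a :
  cf_up O corr a [::] = (ei *m p0) a 0.
Proof.
by rewrite ratmx_mulE; apply: eq_bigr => c _; rewrite [onept _ _ _]mxE.
Qed.

Lemma t0E a : tvar L 0 a = t0^T a 0.
Proof. by rewrite !mxE /ttilde subr0. Qed.

Lemma quad_t0 (K : 'M[rat]_N.+1) :
  \sum_a \sum_c K a c *: (tvar L 0 a * tvar L 0 c)
  = (t0 *m (ratmx K *m t0^T)) 0 0.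
Proof.
rewrite mulmxA; have := quad_mx K t0^T t0^T; rewrite trmxK => ->.
by apply: eq_bigr => a _; apply: eq_bigr => c _; rewrite (t0E a) (t0E c).
Qed.

Lemma trr_matrix : topological_recursion O corr ->
  two_point_recursion F (invmx (Defs.eta O)).
Proof.
move=> trr [j c] m k; apply/matrixP => a e.
have deriv_mx3 n s : deriv_mx (j, c) (twopt m n) a s
    = series_deriv (n, s) (series_deriv (m, a) (series_deriv (j, c) F)).
  rewrite !mxE (series_derivC (j, c)) (series_derivC (j, c) (n, s)).
  by rewrite series_derivC.
have := trr k.+1 m j e a c isT.
have -> : k.+1%:Z - 1 = k%:Z by rewrite -addn1 PoszD addrK.
move=> trrE; rewrite deriv_mx3; apply: etrans trrE _; rewrite mxE.
apply: eq_bigr => s _; rewrite mulrC.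
congr (_ * _); last by rewrite mxE; exact: series_derivC.
rewrite mxE; apply: eq_bigr => r _; rewrite deriv_mx3 mulrC ratmxE.
by congr (_ *: _); rewrite -{1}tr_eta -trmx_inv mxE.
Qed.

Lemma string_matrix : string_equation O corr ->
  tilde_sum (delay onept) = - ((2%:R^-1)%:A *: (t0 *m et *m t0^T)).
Proof.
rewrite -[t0 *m et *m _]mulmxA.
rewrite /string_equation (isum_col (fun m a => cf_delay m a)) quad_t0 => e.
by apply/matrixP => i j; rewrite !ord1 e !mxE mulr_algl.
Qed.

Lemma dilaton_matrix : dilaton_equation corr -> tilde_sum onept = (2%:R * F)%:M.
Proof.
rewrite /dilaton_equation (isum_col (fun m a => cf_onept m a)) => e.
by apply/matrixP => i j; rewrite !ord1 e mxE mulr1n scaler_nat mulr_natl.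
Qed.

Lemma hori_matrix : hori_equation O corr ->
  tilde_sum (fun m => D m *m onept m + C *m delay onept m) =
  - ((2%:R^-1)%:A *: (t0 *m (C *m et) *m t0^T)).
Proof.
rewrite /hori_equation (isum_diag _ (fun m a => cf_onept m a)).
rewrite (isum_mx (K := fun=> Cmx O) _ (fun m a => cf_delay m a)) // quad_t0 => e.
rewrite -[t0 *m _ *m _]mulmxA tilde_sumD; apply/matrixP => i j.
rewrite !ord1 [LHS]mxE e -ratmxM.
by rewrite /Clow expr1 !mxE mulr_algl.
Qed.

End Translation.

(** * Elimination of the boundary terms *)

Lemma telescope (M : zmodType) (w q X : M) : w + (X - (w + q)) = X - q.
Proof. by rewrite opprD (addrCA X) addNKr. Qed.

Lemma cancel1 (M : zmodType) (u v w z X : M) :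
  u + v + (w + (X - (w + (v + z)))) = - X -> X + X + u - z = 0.
Proof.
rewrite telescope -addrA telescope => e; apply: (addrI (- X)).
by rewrite addr0 -[RHS]e -!addrA addKr addrCA.
Qed.

Lemma cancel2 (M : zmodType) (al be ga de ep w z X : M) :
  al + (be + ga) + (de + ep + (w + (X - (w + (ep + (ga + z)))))) = - X ->
  X + X + (de + al) + be - z = 0.
Proof.
rewrite telescope -(addrA de) telescope (addrA al) -(addrA _ ga) (addrA de).
rewrite telescope => e; apply: (addrI (- X)); rewrite addr0 -[RHS]e.
by rewrite -!addrA addKr [LHS](AC (1*(1*(1*2))) (3*(4*(2*(1*5))))).
Qed.

Lemma symmetrize_quad (R : comNzRingType) n
    (K D C M : 'M[R]_n) (u w : 'cV[R]_n) :
  K^T = K -> D^T = D ->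
  u^T *m K *m (D *m w + C *m u) + (D *m w + C *m u)^T *m K *m u + u^T *m M *m u
  = w^T *m (D *m K) *m u + w^T *m (D *m K) *m u
    + u^T *m (K *m C + C^T *m K + M) *m u.
Proof.
move=> sK sD; have e : u^T *m K *m D *m w = w^T *m D *m K *m u.
  have /matrixP/(_ 0 0) : (u^T *m K *m D *m w)^T = w^T *m D *m K *m u.
    by rewrite !trmx_mul trmxK sK sD !mulmxA.
  by rewrite mxE => e; apply/matrixP => i j; rewrite !ord1.
rewrite trmx_add !trmx_mul sD !(mulmxDl, mulmxDr) !mulmxA e -!addrA.
by congr (_ + _); rewrite addrCA.
Qed.

(** A one-by-one matrix equals its transpose, so the quadratic terms of the
    second constraint may be symmetrized; [D], [D1], [J] stand for [D_0],
    [D_1], [eta^-1]. *)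
Lemma boundary2_quad (R : comNzRingType) n (D D1 J C X Y : 'M[R]_n)
    (u w : 'cV[R]_n) :
  (D *m J *m D)^T = D *m J *m D -> D1^T = D1 ->
  D1 *m (D *m J *m D) = - (X *m J) ->
  D *m J *m D *m C + C^T *m (D *m J *m D) + D *m J *m C *m D
    = - (C^T *m Y *m J) ->
  u^T *m D *m J *m D *m (D1 *m w + C *m u)
    + (D1 *m w + C *m u)^T *m D *m J *m D *m u + u^T *m D *m J *m C *m D *m u
  = - (w^T *m X *m (J *m u) + w^T *m X *m (J *m u))
    - (C *m u)^T *m Y *m (J *m u).
Proof.
move=> sK sD1 D1K quad.
have := symmetrize_quad C (D *m J *m C *m D) u w sK sD1.
rewrite D1K quad !(mulmxN, mulNmx) trmx_mul !mulmxA -opprD => <-.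
by [].
Qed.

(** The terms produced by unrolling the recursion twice or three times, in an
    arbitrary commutative ring. Here [t], [p0], [p1] stand for [t_0], [p_0],
    [p_1], the letters [D], [D1], [E], [J] for [D_0], [D_1], [eta], [eta^-1],
    and [X] for the sum of the main terms. *)
Section BoundaryTerms.
Variables (R : comNzRingType) (n : nat).
Variables (C D D1 E J : 'M[R]_n) (t : 'rV[R]_n) (p0 p1 : 'cV[R]_n).
Hypotheses (sD : D^T = D) (sE : E^T = E) (EJ : E *m J = 1%:M).
Hypothesis CJ : C^T *m J = J *m C.
Variable X : 'M[R]_1.

Variable Y : 'M[R]_n.
Hypothesis DJD : D *m J *m D = Y *m J.

Let a0 := E *m t^T.
Let b0 := D *m p0 + C *m a0.
Let b1 := D1 *m p1 + C *m p0.
Let c0 := D *m b1 + C *m b0.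

Lemma a0J : a0^T *m J = t.
Proof. by rewrite trmx_mul trmxK sE -mulmxA EJ mulmx1. Qed.

(** Passing from one step of the recursion to the next multiplies the row
    [v^T J] by [C] on the right, because [C] is self-adjoint. *)
Lemma stepJ (u v : 'cV[R]_n) (w : 'rV[R]_n) :
  v^T *m J = w -> (D *m u + C *m v)^T *m J = u^T *m D *m J + w *m C.
Proof.
by move=> <-; rewrite trmx_add !trmx_mul sD mulmxDl -!(mulmxA v^T) CJ.
Qed.

Lemma boundary1 :
  b0^T *m J *m D *m p0 + (a0^T *m J *m D *m b1 + (X - t *m c0)) = - X ->
  X + X + p0^T *m Y *m (J *m p0) - t *m (C *m C *m E *m t^T) = 0.
Proof.
have -> : p0^T *m Y *m (J *m p0) = p0^T *m D *m J *m D *m p0.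
  by rewrite !mulmxA -(mulmxA _ Y) -DJD !mulmxA.
rewrite {1}/b0 (stepJ _ a0J) a0J /c0 /b0 /a0 !(mulmxDl, mulmxDr, mulmxA).
exact: cancel1.
Qed.

Variable c1 : 'cV[R]_n.
Let d0 := D *m c1 + C *m c0.

Variable W : 'M[R]_n.
Hypotheses (sDJD : (D *m J *m D)^T = D *m J *m D) (sD1 : D1^T = D1).
Hypothesis D1DJD : D1 *m (D *m J *m D) = - (W *m J).
Variable Z : 'M[R]_n.
Hypothesis quad : D *m J *m D *m C + C^T *m (D *m J *m D) + D *m J *m C *m D
  = - (C^T *m Z *m J).

Lemma boundary2 :
  c0^T *m J *m D *m p0 + (b0^T *m J *m D *m b1
    + (a0^T *m J *m D *m c1 + (X - t *m d0))) = - X ->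
  X + X + (- (p1^T *m W *m (J *m p0) + p1^T *m W *m (J *m p0))
           - (C *m p0)^T *m Z *m (J *m p0))
    - t *m (C *m C *m C *m E *m t^T) = 0.
Proof.
rewrite -(boundary2_quad _ _ sDJD sD1 D1DJD quad) -/b1.
rewrite {1}/c0 (stepJ _ (stepJ _ a0J)) (stepJ _ a0J) a0J /d0 /c0 {1}/b0 /a0.
rewrite !(mulmxDl, mulmxDr, mulmxA).
by rewrite (addrA (X + X)); exact: cancel2.
Qed.

End BoundaryTerms.

(** * The tower of Virasoro vector fields *)

(* From here on these objects are handled only through their identities. *)
#[local] Opaque ratmx tilde_sum tilde_row twopt onept third_deriv_sum
  grading Cmx Defs.eta.

Lemma solve_for_middle (M : zmodType) (a b c d r k : M) :
  a + b + c + d + r = - k -> c + d = - (r + a + (b + k)).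
Proof.
move=> e; apply/eqP; rewrite -addr_eq0; apply/eqP.
by rewrite (AC (2*(2*2)) (4*5*1*2*3*6)) /= e addNr.
Qed.

Section VirasoroRecursion.
Variables (d : nat) (H : falgType rat) (V : even_cohomology d H).
Variables (N : nat) (O : homogeneous_basis V N) (L : comAlgType rat).
Local Notation I := (nat * 'I_N.+1)%type.
Local Notation S := (series I L).
Local Notation ratmx := (@ratmx I L).
Variable F : S.
Local Notation onept := (onept F).
Local Notation twopt := (twopt F).
Local Notation t0 := (tilde_row N L 0).
Local Notation et := (ratmx (Defs.eta O)).
Local Notation ei := (ratmx (invmx (Defs.eta O))).
Local Notation C := (ratmx (Cmx O)).
Local Notation D n := (ratmx (grading O n)).

Lemma mul_eta_inv : et *m ei = 1%:M.
Proof. by rewrite -ratmxM mulmxV ?eta_unit // ratmx1. Qed.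

Lemma mul_inv_eta : ei *m et = 1%:M.
Proof. by rewrite -ratmxM mulVmx ?eta_unit // ratmx1. Qed.

Lemma tr_ei : ei^T = ei.
Proof. by rewrite tr_ratmx trmx_inv tr_eta. Qed.

Lemma tr_D n : (D n)^T = D n.
Proof. by rewrite tr_ratmx tr_diag_mx. Qed.

Lemma eta_trC : et *m C^T = C *m et.
Proof. by rewrite -[RHS]ratmxM -tr_C_eta tr_ratmx -ratmxM trmx_mul tr_eta. Qed.

Lemma trC_ei : C^T *m ei = ei *m C.
Proof. by rewrite tr_ratmx -!ratmxM trC_eta_inv. Qed.

Hypothesis trr : two_point_recursion F (invmx (Defs.eta O)).
Hypothesis string : tilde_sum (delay onept) =
  - ((2%:R^-1)%:A *: (t0 *m et *m t0^T)).
Hypothesis dilaton : tilde_sum onept = (2%:R * F)%:M.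
Hypothesis hori : tilde_sum (fun m => D m *m onept m + C *m delay onept m) =
  - ((2%:R^-1)%:A *: (t0 *m (C *m et) *m t0^T)).

(** Two-point functions with second index [n - 1], where [p_(-1) = eta t_0^T]
    has the derivative [eta] along [t_0] and zero along the other variables. *)
Definition twopt_ext k n : 'M[S]_N.+1 :=
  if n is l.+1 then twopt k l else if k is 0%N then et else 0.

Lemma string_constraint : tilde_sum (fun m => ratmx 0 *m onept m
    + ratmx 1%:M *m delay onept m) = - ((2%:R^-1)%:A *: (t0 *m et *m t0^T)).
Proof.
rewrite -string; apply: eq_tilde_sum => m.
by rewrite ratmx1 mul1mx ratmx0 mul0mx add0r.
Qed.

Lemma string_deriv n :
  tilde_sum (delay (twopt^~ n))
  = - (delay onept n)^T - (n == 0)%N%:R *: (t0 *m et).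
Proof.
have := constraint_deriv (A := fun=> 0) (tr_eta O) string_constraint n.
rewrite ratmx1 mul1mx ratmx0 mul0mx add0r.
move=> /(canRL (addKr _)) <-; apply: eq_tilde_sum => m.
by rewrite /= mul0mx add0r mul1mx.
Qed.

(** Multiplication by z maps tangent vectors to tangent vectors. In the second
    derivative of the string equation, the recursion expresses the third
    derivatives at [(k + 1, n + 1)] through those at [(k + 1, 0)], where the
    equation itself gives their value [- Phi_(k,0)]. *)
Lemma twopt_shift k n :
  twopt_ext k.+1 n = twopt k 0 *m ei *m twopt_ext 0 n - twopt k n.
Proof.
have d2 := constraint_deriv2 (A := fun=> 0) (tr_eta O) string_constraint.
have {}d2 m j : delay (twopt^~ j) m + delay (twopt m) j
    + third_deriv_sum F (fun=> 0) 1%:M m j = - ([&& m == 0 & j == 0]%N%:R *: et).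
  rewrite -d2 ratmx1 trmx1 mulmx1 mul1mx ratmx0 trmx0 mul0mx mulmx0.
  by rewrite add0r addr0.
case: n => [|n] /=.
  by rewrite -mulmxA mul_inv_eta mulmx1 subrr.
have := d2 k.+1 n.+1; rewrite (third_deriv_sumS trr) /= scale0r oppr0.
have /eqP := d2 k.+1 0; rewrite /= scale0r oppr0 addr0 addrC addr_eq0 => /eqP ->.
by rewrite !mulNmx => /eqP; rewrite subr_eq0 addrC => /eqP <-; rewrite addrK.
Qed.

Definition hori_third k n : 'M[S]_N.+1 :=
  (third_deriv_sum F (grading O) (Cmx O) n k)^T.

Lemma hori_thirdS k n : hori_third k.+1 n = twopt k 0 *m ei *m hori_third 0 n.
Proof.
by rewrite /hori_third (third_deriv_sumS trr) !trmx_mul tr_ei tr_twopt mulmxA.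
Qed.

(** The second derivative of Hori's equation. The boundary term
    [C eta = eta C^T] of its right-hand side is absorbed in [twopt_ext]. *)
Lemma hori_deriv2 k n :
  D k *m twopt k n + C *m delay (twopt^~ n) k
  = - (hori_third k n + twopt k n *m D n + twopt_ext k n *m C^T).
Proof.
have hori' : tilde_sum (fun m => D m *m onept m + C *m delay onept m) =
    - ((2%:R^-1)%:A *: (t0 *m ratmx (Cmx O *m Defs.eta O) *m t0^T)).
  by rewrite ratmxM.
have := constraint_deriv2 (tr_C_eta O) hori' n k.
move/(congr1 trmx).
have delayT (v : nat -> 'M[S]_N.+1) j : (delay v j)^T = delay (fun i => (v i)^T) j.
  by case: j => //=; rewrite trmx0.
rewrite raddfN /= [(_ *: _)^T]linearZ /=.
rewrite [(ratmx (_ *m _))^T]tr_ratmx tr_C_eta 4!trmx_add.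
rewrite !trmx_mul !trmxK -/(hori_third k n) tr_D !tr_twopt !delayT.
have -> : (fun i => (twopt n i)^T) = twopt^~ n.
  by apply: funext => i; rewrite tr_twopt.
have -> : (fun i => (twopt i k)^T) = twopt k.
  by apply: funext => i; rewrite tr_twopt.
move=> e; have -> : twopt_ext k n *m C^T = delay (twopt k) n *m C^T
    + ((n == 0) && (k == 0))%N%:R *: ratmx (Cmx O *m Defs.eta O).
  rewrite ratmxM -eta_trC /twopt_ext; case: n {e} => [|n] /=.
    by rewrite mul0mx add0r; case: k => [|k] /=; rewrite ?mul0mx ?scale1r ?scale0r.
  by rewrite scale0r addr0.
exact: solve_for_middle e.
Qed.

(** [vir_rhs i] is the family [P] attached to the operator l_(i-1): the string
    equation is the case [i = 0], and one step applies l_0 z. *)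
Fixpoint vir_rhs i (n : nat) : 'cV[S]_N.+1 :=
  if i is j.+1 then D n *m vir_rhs j n.+1 + C *m vir_rhs j n
  else delay onept n + (n == 0)%N%:R *: (et *m t0^T).

(** The action of the vector field with coefficients [l_(i-1) f] on a family
    indexed by the level. Multiplication by z, followed by correction along the
    primary fields to stay tangent, adds the first summand; the adjoint of l_0
    gives the argument of the second. *)
Fixpoint vir_field i r (v : nat -> 'M[S]_(N.+1, r)) : 'rV[S]_r :=
  if i is j.+1 then
    (vir_rhs j 0)^T *m ei *m D 0 *m v 0
    + vir_field j (fun k => D k.+1 *m v k.+1 + C *m v k)
  else tilde_sum (delay v).

Lemma vir_field_mul i r s (v : nat -> 'M[S]_(N.+1, r)) (A : 'M_(r, s)) :
  vir_field i (fun k => v k *m A) = vir_field i v *m A.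
Proof.
elim: i v => [|i IHi] v /=.
  by rewrite -tilde_sumM; apply: eq_tilde_sum; case => [|m] /=; rewrite ?mul0mx.
rewrite mulmxDl -IHi mulmxA; congr (_ + _); congr vir_field; apply: funext => k.
by rewrite mulmxDl !mulmxA.
Qed.

Lemma vir_field_add i r (v w : nat -> 'M[S]_(N.+1, r)) :
  vir_field i (fun k => v k + w k) = vir_field i v + vir_field i w.
Proof.
elim: i v w => [|i IHi] v w /=.
  by rewrite -tilde_sumD; apply: eq_tilde_sum; case => [|m] /=; rewrite ?addr0.
rewrite mulmxDr addrACA -IHi; congr (_ + _); congr vir_field.
apply: funext => k.
by rewrite !mulmxDr addrACA.
Qed.

Lemma vir_field_opp i r (v : nat -> 'M[S]_(N.+1, r)) :
  vir_field i (fun k => - v k) = - vir_field i v.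
Proof.
rewrite -[RHS]mulmx1 mulNmx -mulmxN -vir_field_mul; congr vir_field.
apply: funext => k.
by rewrite mulmxN mulmx1.
Qed.

(** If the vector field of order [i] is tangent with right-hand side [P], its
    product with z acts on the two-point functions as the shift of [P]. *)
Lemma vir_field_ext_shift i n :
  (forall n, vir_field i (twopt^~ n) = - (vir_rhs i n)^T) ->
  vir_field i (fun k => twopt_ext k.+1 n)
  = - ((vir_rhs i 0)^T *m ei *m twopt_ext 0 n) + (vir_rhs i n)^T.
Proof.
move=> con.
have -> : (fun k => twopt_ext k.+1 n)
    = (fun k => twopt k 0 *m (ei *m twopt_ext 0 n) + - twopt k n).
  by apply: funext => k; rewrite twopt_shift mulmxA.
by rewrite vir_field_add vir_field_mul vir_field_opp !con opprK mulNmx mulmxA.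
Qed.

(** The induction step combines the tangency of l_0 with stability under z. The
    third derivatives cancel, because by the topological recursion the corrected
    product with z annihilates every derivative of a two-point function. *)
Lemma vir_field_twopt i n : vir_field i (twopt^~ n) = - (vir_rhs i n)^T.
Proof.
elim: i n => [|i con] n.
  rewrite /= string_deriv trmx_add opprD; congr (_ - _).
  by rewrite [RHS]linearZ /= trmx_mul trmxK tr_ratmx tr_eta.
rewrite /=; set P0 := (vir_rhs i 0)^T.
have -> : (fun k => D k.+1 *m twopt k.+1 n + C *m twopt k n) = (fun k =>
    - (twopt k 0 *m (ei *m hori_third 0 n) + twopt_ext k.+1 n.+1 *m D n
       + twopt_ext k.+1 n *m C^T)).
  by apply: funext => k; rewrite (hori_deriv2 k.+1 n) hori_thirdS !mulmxA.
rewrite vir_field_opp !vir_field_add !vir_field_mul con.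
rewrite !(vir_field_ext_shift _ con) -/P0.
have := hori_deriv2 0 n; rewrite /= mulmx0 addr0 -mulmxA => ->.
rewrite trmx_add !trmx_mul tr_D mulNmx !mulmxDl !mulmxN !mulmxDr !mulNmx !mulmxA.
rewrite -!opprD; congr (- _).
by rewrite addrACA addNKr addrACA subrr add0r addNKr.
Qed.

(** The derivative of the dilaton equation. *)
Lemma dilaton_deriv k : tilde_sum (fun j => (twopt k j)^T) = (onept k)^T.
Proof.
apply: col_inj => b; have := congr1 (@deriv_mx _ _ (k, b) _ _) dilaton.
rewrite deriv_mx_double deriv_mx_tilde_sum row_onept mulr2n raddfD /= => /addrI e.
rewrite -[RHS]tr_row row_onept tr_scalar_mx -e col_tilde_sum.
apply: eq_tilde_sum => m.
by rewrite deriv_mx_onept tr_twopt.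
Qed.

Lemma vir_field_exchange i (f : nat -> nat -> 'M[S]_N.+1) :
  vir_field i (fun k => (tilde_sum (fun j => (f k j)^T))^T)
  = tilde_sum (fun j => (vir_field i (fun k => f k j))^T).
Proof.
elim: i f => [|i IHi] f /=.
  pose g k j := delay (f^~ j) k.
  have := tilde_sum_exchange g; rewrite /g => <-; apply: eq_tilde_sum => k.
  case: k => [|k] //=; apply: trmx_inj; rewrite trmx0 trmxK -[LHS]tilde_sum0.
  by apply: eq_tilde_sum => j; rewrite trmx0.
move: (vir_rhs i 0)^T => P0; set c := P0 *m ei *m D 0.
have cE : c *m (tilde_sum (fun j => (f 0 j)^T))^T
    = tilde_sum (fun j => (c *m f 0 j)^T).
  rewrite -[LHS]trmx11 trmx_mul trmxK -tilde_sumM; apply: eq_tilde_sum => j.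
  exact: esym (trmx_mul _ _).
rewrite cE [X in vir_field i X](_ : _ =
    fun k => (tilde_sum (fun j => (D k.+1 *m f k.+1 j + C *m f k j)^T))^T);
  last first.
  apply: funext => k; apply: trmx_inj; rewrite trmxK trmx_add !trmx_mul !trmxK.
  rewrite -!tilde_sumM -tilde_sumD; apply: eq_tilde_sum => j.
  by rewrite trmx_add !trmx_mul.
rewrite IHi -tilde_sumD; apply: eq_tilde_sum => j.
by rewrite trmx_add.
Qed.

(** Isotropy of the tangent space: contracting the tangency statement with the
    shifted variables gives the same double sum as applying the vector field to
    [p]. *)
Lemma virasoro i : vir_field i onept = - tilde_sum (vir_rhs i).
Proof.
have -> : onept = fun k => (tilde_sum (fun j => (twopt k j)^T))^T.
  by apply: funext => k; rewrite dilaton_deriv trmxK.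
rewrite vir_field_exchange -tilde_sumN; apply: eq_tilde_sum => j.
by rewrite vir_field_twopt raddfN /= trmxK.
Qed.

End VirasoroRecursion.

(** * The first two constraints *)

Section Unrolling.
Variables (d : nat) (H : falgType rat) (V : even_cohomology d H).
Variables (N : nat) (O : homogeneous_basis V N) (L : comAlgType rat).
Local Notation I := (nat * 'I_N.+1)%type.
Local Notation S := (series I L).
Local Notation ratmx := (@ratmx I L).
Variable F : S.
Local Notation onept := (onept F).
Local Notation twopt := (twopt F).
Local Notation t0 := (tilde_row N L 0).
Local Notation et := (ratmx (Defs.eta O)).
Local Notation ei := (ratmx (invmx (Defs.eta O))).
Local Notation C := (ratmx (Cmx O)).
Local Notation D n := (ratmx (grading O n)).
Local Notation P := (vir_rhs O F).
Local Notation p0 := (onept 0).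
Local Notation p1 := (onept 1).
Local Notation b := (bq O).
Local Notation W := (ratmx (diag_fun (fun a => (b a - 1) * b a * (b a + 1)))).
Local Notation Z := (ratmx (diag_fun (fun a => 3 * b a ^+ 2 - 1))).

Hypothesis vir : forall i, vir_field O F i onept = - tilde_sum (vir_rhs O F i).

Lemma vir_field_vir_rhs0 j :
  vir_field O F 0 (fun k => P j k.+1) = tilde_sum (P j) - t0 *m P j 0.
Proof.
rewrite -tilde_sum_head -tilde_sumB /=; apply: eq_tilde_sum.
move=> -[|m] /=; rewrite ?subrr //.
by rewrite subr0.
Qed.

Lemma vir_rhs0S k : P 0 k.+1 = onept k.
Proof. by rewrite /= scale0r addr0. Qed.

Lemma vir_rhsS i n : P i.+1 n = D n *m P i n.+1 + C *m P i n.
Proof. by []. Qed.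

(** The shifted families [P j] are mapped to one another by the same step as in
    [vir_rhs], so the vector field is evaluated on [p] by unrolling. *)
Lemma vir_field_vir_rhsS i j : vir_field O F i.+1 (fun k => P j k.+1)
  = (P i 0)^T *m ei *m D 0 *m P j 1 + vir_field O F i (fun k => P j.+1 k.+1).
Proof. by []. Qed.

Lemma vir_field_onept i :
  vir_field O F i (fun k => P 0 k.+1) = - tilde_sum (P i).
Proof.
by rewrite -vir; congr vir_field; apply: funext => k; rewrite vir_rhs0S.
Qed.

Lemma vir_rhs00 : P 0 0 = et *m t0^T.
Proof. by rewrite /= add0r scale1r. Qed.

#[local] Opaque vir_rhs vir_field.

(** Twice the L_1 constraint: [P 2] is the family of l_1 and the index starts
    from l_(-1). *)
Lemma virasoro1 : tilde_sum (P 2) + tilde_sum (P 2)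
  + p0^T *m ratmx (diag_fun (fun a => b a * (1 - b a))) *m (ei *m p0)
  - t0 *m (C *m C *m et *m t0^T) = 0.
Proof.
have eE : et^T = et by rewrite tr_ratmx tr_eta.
have := vir_field_onept 2.
rewrite (vir_field_vir_rhsS 1 0) (vir_field_vir_rhsS 0 1) (vir_field_vir_rhs0 2).
rewrite (vir_rhsS 1 0) (vir_rhsS 0 0) (vir_rhsS 0 1) vir_rhs00.
rewrite (vir_rhs0S 0) (vir_rhs0S 1).
apply: (boundary1 (tr_D O L 0) eE (mul_eta_inv O L) (trC_ei O L)).
by rewrite -!ratmxM grading_eta_inv_grading.
Qed.

Lemma virasoro2 : tilde_sum (P 3) + tilde_sum (P 3)
  + (- (p1^T *m W *m (ei *m p0) + p1^T *m W *m (ei *m p0))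
     - (C *m p0)^T *m Z *m (ei *m p0))
  - t0 *m (C *m C *m C *m et *m t0^T) = 0.
Proof.
have eE : et^T = et by rewrite tr_ratmx tr_eta.
have := vir_field_onept 3.
rewrite (vir_field_vir_rhsS 2 0) (vir_field_vir_rhsS 1 1) (vir_field_vir_rhsS 0 2).
rewrite (vir_field_vir_rhs0 3).
rewrite (vir_rhsS 2 0) (vir_rhsS 1 0) (vir_rhsS 0 0) (vir_rhsS 0 1) vir_rhs00.
rewrite (vir_rhs0S 0) (vir_rhs0S 1).
apply: (boundary2 (tr_D O L 0) eE (mul_eta_inv O L) (trC_ei O L) _ (tr_D O L 1)).
- by rewrite -!ratmxM tr_ratmx !trmx_mul trmx_inv tr_eta !tr_diag_mx mulmxA.
- by rewrite -!ratmxM grading1_eta_inv_grading ratmxN.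
- by rewrite tr_ratmx -!ratmxM -!ratmxD -ratmxN quad02_matrix.
Qed.

End Unrolling.

Section Expansion.
Variables (R : comNzRingType) (n : nat) (D D1 D2 C : 'M[R]_n).
Variables (q3 q2 q1 q0 : 'cV[R]_n).
Hypotheses (CD : C *m D = D1 *m C) (CD1 : C *m D1 = D2 *m C).

Lemma expand2 : D *m (D1 *m q2 + C *m q1) + C *m (D *m q1 + C *m q0)
  = D *m D1 *m q2 + (D + D1) *m C *m q1 + C *m C *m q0.
Proof.
by rewrite !(mulmxDr, mulmxDl) !mulmxA CD -!addrA.
Qed.

Lemma expand3 :
  D *m (D1 *m D2 *m q3 + (D1 + D2) *m C *m q2 + C *m C *m q1)
  + C *m (D *m D1 *m q2 + (D + D1) *m C *m q1 + C *m C *m q0)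
  = D *m D1 *m D2 *m q3 + (D *m (D1 + D2) + D1 *m D2) *m C *m q2
    + (D + D1 + D2) *m C *m C *m q1 + C *m C *m C *m q0.
Proof.
rewrite !(mulmxDr, mulmxDl) !mulmxA CD -(mulmxA _ C D1) CD1 !mulmxA -!addrA.
do 3!congr (_ + _).
by rewrite addrCA.
Qed.
End Expansion.

Section FinalForms.
Variables (d : nat) (H : falgType rat) (V : even_cohomology d H).
Variables (N : nat) (O : homogeneous_basis V N) (L : comAlgType rat).
Variable corr : {mset nat * 'I_N.+1}%mset -> L.
Local Notation I := (nat * 'I_N.+1)%type.
Local Notation S := (series I L).
Local Notation ratmx := (@ratmx I L).
Local Notation F := (F0 corr).
Local Notation onept := (onept F).
Local Notation t0 := (tilde_row N L 0).
Local Notation eta := (Defs.eta O).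
Local Notation J := (invmx (Defs.eta O)).
Local Notation C := (Cmx O).
Local Notation D n := (grading O n).
Local Notation P := (vir_rhs O F).
Local Notation p0 := (onept 0).
Local Notation b := (bq O).

Lemma tilde_sum_vir_rhs0 (K : 'M[rat]_N.+1) :
  tilde_sum (fun m => ratmx K *m P 0 m)
  = tilde_sum (fun m => ratmx K *m delay onept m)
    + t0 *m (ratmx (K *m eta) *m t0^T).
Proof.
rewrite -tilde_sum_head -tilde_sumD; apply: eq_tilde_sum => -[|m].
  by rewrite vir_rhs00 mulmx0 add0r ratmxM mulmxA.
by rewrite vir_rhs0S addr0.
Qed.

Lemma ratmx_C_graded m : ratmx C *m ratmx (D m) = ratmx (D m.+1) *m ratmx C.
Proof. by rewrite -!ratmxM C_graded. Qed.

(** The relation [C D_n = D_(n+1) C] moves all gradings to the left. *)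
Lemma vir_rhs2E n : P 2 n =
  ratmx (D n *m D n.+1) *m onept n.+1 + ratmx ((D n + D n.+1) *m C) *m onept n
  + ratmx (C *m C) *m P 0 n.
Proof.
rewrite (vir_rhsS O F 1 n) (vir_rhsS O F 0 n) (vir_rhsS O F 0 n.+1) !vir_rhs0S.
by rewrite (expand2 _ _ _ (ratmx_C_graded n)) !ratmxM ratmxD.
Qed.

Lemma vir_rhs3E n : P 3 n =
  ratmx (D n *m D n.+1 *m D n.+2) *m onept n.+2
  + ratmx ((D n *m (D n.+1 + D n.+2) + D n.+1 *m D n.+2) *m C) *m onept n.+1
  + ratmx ((D n + D n.+1 + D n.+2) *m C *m C) *m onept n
  + ratmx (C *m C *m C) *m P 0 n.
Proof.
rewrite (vir_rhsS O F 2 n) (vir_rhs2E n) (vir_rhs2E n.+1) vir_rhs0S.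
rewrite !(ratmxM, ratmxD); exact: expand3 (ratmx_C_graded n) (ratmx_C_graded n.+1).
Qed.

Lemma tilde_sum_vir_rhs2 : tilde_sum (P 2) =
  tilde_sum (fun m =>
    ratmx (diag_fun (fun a => (m%:R + b a) * (m%:R + b a + 1))) *m onept m.+1)
  + tilde_sum (fun m => ratmx ((D m + D m.+1) *m C) *m onept m)
  + tilde_sum (fun m => ratmx (C *m C) *m delay onept m)
  + t0 *m (ratmx (C *m C *m eta) *m t0^T).
Proof.
have diag1 m : ratmx (D m *m D m.+1) *m onept m.+1
    = ratmx (diag_fun (fun a => (m%:R + b a) * (m%:R + b a + 1))) *m onept m.+1.
  by rewrite grading_mul2.
apply: etrans _ (addrA _ _ _).
apply: etrans (eq_tilde_sum vir_rhs2E) _.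
apply: etrans (tilde_sumD _ _) _.
apply: (congr2 +%R _ (tilde_sum_vir_rhs0 (C *m C))).
apply: etrans (tilde_sumD _ _) _.
exact: (congr2 +%R (eq_tilde_sum diag1) erefl).
Qed.

Lemma tilde_sum_vir_rhs3 : tilde_sum (P 3) =
  tilde_sum (fun m => ratmx (diag_fun (fun a =>
         (m%:R + b a) * (m%:R + b a + 1) * (m%:R + b a + 2))) *m onept m.+2)
  + tilde_sum (fun m =>
      ratmx ((D m *m (D m.+1 + D m.+2) + D m.+1 *m D m.+2) *m C) *m onept m.+1)
  + tilde_sum (fun m => ratmx ((D m + D m.+1 + D m.+2) *m C *m C) *m onept m)
  + tilde_sum (fun m => ratmx (C *m C *m C) *m delay onept m)
  + t0 *m (ratmx (C *m C *m C *m eta) *m t0^T).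
Proof.
have diag2 m : ratmx (D m *m D m.+1 *m D m.+2) *m onept m.+2
    = ratmx (diag_fun (fun a =>
        (m%:R + b a) * (m%:R + b a + 1) * (m%:R + b a + 2))) *m onept m.+2.
  by rewrite grading_mul3.
apply: etrans _ (addrA _ _ _).
apply: etrans (eq_tilde_sum vir_rhs3E) _.
apply: etrans (tilde_sumD _ _) _.
apply: (congr2 +%R _ (tilde_sum_vir_rhs0 (C *m C *m C))).
apply: etrans (tilde_sumD _ _) _.
apply: (congr2 +%R _ erefl); apply: etrans (tilde_sumD _ _) _.
exact: (congr2 +%R (eq_tilde_sum diag2) erefl).
Qed.

Lemma quad_diag (f : 'I_N.+1 -> rat) (u w : 'cV[S]_N.+1) :
  (u^T *m ratmx (diag_fun f) *m w) 0 0 = \sum_a f a *: (u a 0 * w a 0).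
Proof.
rewrite -mulmxA mxE; apply: eq_bigr => a _.
by rewrite ratmx_diagE [u^T _ _]mxE scalerAr.
Qed.

(** The term [t] enters [l + t] twice and is subtracted once, since the family
    at level 0 contains [p_(-1)] in place of zero. *)
Lemma half_solve (l q t : S) : l + t + (l + t) + q - t = 0 ->
  l + 2%:R^-1 *: q + 2%:R^-1 *: t = 0.
Proof.
move=> e; have l2 : l = 2%:R^-1 *: (l + l).
  by rewrite -mulr2n -scaler_nat scalerA mulVf ?scale1r.
rewrite {1}l2 -!scalerDr (_ : l + l + q + t = 0) ?scaler0 // -[RHS]e.
by rewrite [RHS](AC (2*2*1*1) (1*3*5*2*(4*6))) /= subrr addr0.
Qed.

Lemma half_solve_mx1 (l1 l2 l3 q t : 'M[S]_1) :
  l1 + l2 + l3 + t + (l1 + l2 + l3 + t) + q - t = 0 ->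
  l1 0 0 + l2 0 0 + l3 0 0 + 2%:R^-1 *: q 0 0 + 2%:R^-1 *: t 0 0 = 0.
Proof.
move=> /(congr1 (fun A : 'M_1 => A 0 0)); rewrite !mxE; exact: half_solve.
Qed.

Lemma half_solve_mx2 (l1 l2 l3 l4 q q' t : 'M[S]_1) :
  l1 + l2 + l3 + l4 + t + (l1 + l2 + l3 + l4 + t) + (- (q + q) - q') - t = 0 ->
  l1 0 0 + l2 0 0 + l3 0 0 + l4 0 0 - q 0 0 - 2%:R^-1 *: q' 0 0
    + 2%:R^-1 *: t 0 0 = 0.
Proof.
move=> e; rewrite -scalerN.
have {}e : l1 + l2 + l3 + l4 - q + t + (l1 + l2 + l3 + l4 - q + t) - q' - t = 0.
  rewrite -[RHS]e; congr (_ - _).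
  rewrite (AC (2*1*(2*1)*1) (1*3*(4*6)*(2*5)*7)) /=.
  by rewrite opprD [RHS]addrA.
move: (congr1 (fun A : 'M_1 => A 0 0) e); rewrite !mxE; exact: half_solve.
Qed.

Lemma Psi01_eq0 : topological_recursion O corr -> string_equation O corr ->
  dilaton_equation corr -> hori_equation O corr -> Psi01 O corr = 0.
Proof.
move=> /trr_matrix trr /string_matrix string /dilaton_matrix dil.
move=> /hori_matrix hori.
have vir := virasoro trr string dil hori.
rewrite /Psi01 (isum_diag _ (fun m a => cf_onept1 corr m a)).
rewrite (isum_mx (K := fun m => (D m + D m.+1) *m C)
  _ (fun m a => cf_onept corr m a)); last first.
  by move=> m a c; rewrite !(grading_diag O) diag_funD diag_funE -natr1; ring.
rewrite (isum_mx (K := fun=> C *m C) _ (fun m a => cf_delay corr m a)) //.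
rewrite quad_t0.
have -> : \sum_a (b a * (1 - b a)) *: (cf corr [:: (0, a)] * cf_up O corr a [::])
    = (p0^T *m ratmx (diag_fun (fun a => b a * (1 - b a)))
       *m (ratmx J *m p0)) 0 0.
  rewrite quad_diag; apply: eq_bigr => a _.
  by rewrite (cf_onept corr 0) cf_up_onept.
have := virasoro1 vir.
rewrite tilde_sum_vir_rhs2.
rewrite -!ratmxM.
have -> : Clow O 2 = C *m C *m eta by rewrite /Clow expr2.
exact: half_solve_mx1.
Qed.

Lemma Psi02_eq0 : topological_recursion O corr -> string_equation O corr ->
  dilaton_equation corr -> hori_equation O corr -> Psi02 O corr = 0.
Proof.
move=> /trr_matrix trr /string_matrix string /dilaton_matrix dil.
move=> /hori_matrix hori.
have vir := virasoro trr string dil hori.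
rewrite /Psi02 (isum_diag _ (fun m a => cf_onept2 corr m a)).
rewrite (isum_mx
  (K := fun m => (D m *m (D m.+1 + D m.+2) + D m.+1 *m D m.+2) *m C)
  _ (fun m a => cf_onept1 corr m a)); last first.
  move=> m a c; rewrite !(grading_diag O) diag_funD !diag_funM diag_funD diag_funE.
  congr (_ * _).
  by rewrite -!natr1; ring.
rewrite (isum_mx (K := fun m => (D m + D m.+1 + D m.+2) *m C *m C)
  _ (fun m a => cf_onept corr m a)); last first.
  move=> m a c; rewrite !(grading_diag O) !diag_funD -mulmxA diag_funE expr2.
  congr (_ * _).
  by rewrite -!natr1; ring.
rewrite (isum_mx (K := fun=> C *m C *m C) _ (fun m a => cf_delay corr m a));
  last first.
  by move=> m a c; rewrite exprS expr2 -!mulmxA.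
rewrite quad_t0.
have -> : \sum_a ((b a - 1) * b a * (b a + 1)) *:
      (cf corr [:: (1, a)] * cf_up O corr a [::])
    = ((onept 1)^T *m ratmx (diag_fun (fun a => (b a - 1) * b a * (b a + 1)))
       *m (ratmx J *m p0)) 0 0.
  rewrite quad_diag; apply: eq_bigr => a _.
  by rewrite (cf_onept corr 1) cf_up_onept.
have -> : \sum_a \sum_c ((3 * b a ^+ 2 - 1) * C a c) *:
      (cf corr [:: (0, c)] * cf_up O corr a [::])
    = ((ratmx C *m p0)^T *m ratmx (diag_fun (fun a => 3 * b a ^+ 2 - 1))
       *m (ratmx J *m p0)) 0 0.
  rewrite quad_diag; apply: eq_bigr => a _.
  rewrite ratmx_mulE mulr_suml scaler_sumr; apply: eq_bigr => c _.
  by rewrite (cf_onept corr 0) cf_up_onept -scalerAl scalerA.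
have := virasoro2 vir.
rewrite tilde_sum_vir_rhs3 -!ratmxM.
have -> : Clow O 3 = C *m C *m C *m eta by rewrite /Clow exprS expr2 -!mulmxA.
exact: half_solve_mx2.
Qed.

End FinalForms.

Theorem theorem0p2 (d : nat) (H : falgType rat) (V : even_cohomology d H)
    (N : nat) (O : homogeneous_basis V N)
    (L : comAlgType rat) (corr : {mset nat * 'I_N.+1}%mset -> L) :
  string_equation O corr ->
  dilaton_equation corr ->
  hori_equation O corr ->
  topological_recursion O corr ->
  Psi01 O corr = 0%R /\ Psi02 O corr = 0%R.
Proof.
by move=> string dilaton hori trr; split; [apply: Psi01_eq0|apply: Psi02_eq0].
Qed.
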